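(* Let $(c,\lambda/\mu)$ be a placed skew shape with $n$ boxes and let $\{n_L \mid L\text{ is a standard tableau of shape }\lambda/\mu\}$ be the natural basis of the $\tilde H_n$-module $\tilde H^{(c,\lambda/\mu)}$. (a) If $w\in S_n$ and $L$ is a standard tableau of shape $\lambda/\mu$ then $$T_wn_L=\sum_Q b_Q\,n_Q,\qquad\text{with coefficients } b_Q\in\mathbb Z[q,q^{-1}].$$ (b) Assume that the content function $c$ takes values in $\mathbb Z$. If $1\le i\le n$ and $L$ is a standard tableau of shape $\lambda/\mu$ then $$x_in_L=\sum_Q b'_Q\,n_Q,\qquad\text{with coefficients } b'_Q\in\mathbb Z[q,q^{-1}].$$ In both sums $Q$ runs over the standard tableaux of shape $\lambda/\mu$.
   Context: **Algebra.** Fix $q\in\mathbb C^*$ which is not a root of unity. The affine Hecke algebra $\tilde H_n$ is the unital associative $\mathbb C$-algebra generated by $T_1,\dots,T_{n-1}$ and invertible elements $x_1,\dots,x_n$ with relations: $T_iT_j=T_jT_i$ if $|i-j|>1$; $T_iT_{i+1}T_i=T_{i+1}T_iT_{i+1}$ for $1\le i\le n-2$; $T_i^2=(q-q^{-1})T_i+1$; $x_ix_j=x_jx_i$; and for $\gamma\in\mathbb Z^n$, $x^\gamma=x_1^{\gamma_1}\cdots x_n^{\gamma_n}$, $$x^\gamma T_i=T_ix^{s_i\gamma}+(q-q^{-1})\frac{(x^\gamma-x^{s_i\gamma})x_{i+1}}{x_{i+1}-x_i},$$ where $s_i=(i,i+1)$ swaps coordinates $i,i+1$ of $\gamma$. For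 $w\in S_n$ with reduced word $w=s_{i_1}\cdots s_{i_p}$, $T_w=T_{i_1}\cdots T_{i_p}$ (independent of the reduced word). **Skew shapes.** Partitions are drawn with boxes pushed up and to the left; rows and columns are numbered as for matrices. For partitions $\mu\subseteq\lambda$, the skew shape $\lambda/\mu$ consists of the boxes of $\lambda$ not in $\mu$. A box in row $r$, column $s$ lies on the diagonal of index $s-r$. The boxes are numbered $\mathrm{box}_1,\dots,\mathrm{box}_n$ along diagonals from southwest to northeast (increasing index; northwest to southeast within a diagonal). A standard tableau of shape $\lambda/\mu$ is a filling of the boxes with $1,\dots,n$ increasing left to right in each row and top to bottom in each column. The column reading tableau $C$ is the standard tableau obtained by entering $1,2,\dots,n$ consecutively down the columns of $\lambda/\mu$, beginning with the southwest-most connected component and filling the columns from left to right. For $w\in S_n$, $wC$ is $C$ with its entries permuted according to $w$. **Placed skew shapes.** Let $\mathbb R+i[0,2\pi/\ln(q^2))=\{a+bi\mid a\in\mathbb R,\ 0\le b<2\pi/\ln(q^2)\}\subseteq\mathbb C$. If $q$ is a positive real number then $x\mapsto q^{2x}=e^{\ln(q^2)x}$ is a bijection from this set to $\mathbb C^*$. A placed skew shape is a pair $(c,\lambda/\mu)$ of a skew shape $\lambda/\mu$ and a content function $c$ from the boxes of $\lambda/\mu$ to $\mathbb R+i[0,2\pi/\ln(q^2))$ such that: $c(\mathrm{box}_j)\ge c(\mathrm{box}_i)$ if $i<j$ and $c(\mathrm{box}_j)-c(\mathrm{box}_i)\in\mathbb Z$; $c(\mathrm{box}_j)=c(\mathrm{box}_i)+1$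 iff $\mathrm{box}_i$ and $\mathrm{box}_j$ are on adjacent diagonals, that of $\mathrm{box}_j$ having index one more than that of $\mathrm{box}_i$; $c(\mathrm{box}_i)=c(\mathrm{box}_j)$ iff they are on the same diagonal. **The module and natural basis.** $\tilde H^{(c,\lambda/\mu)}$ is the $\tilde H_n$-module with $\mathbb C$-basis $\{v_L\}$, $L$ running over standard tableaux of shape $\lambda/\mu$, and action $$x_iv_L=q^{2c(L(i))}v_L,\qquad T_iv_L=(T_i)_{LL}v_L+(q^{-1}+(T_i)_{LL})v_{s_iL},\qquad (T_i)_{LL}=\frac{q-q^{-1}}{1-q^{2(c(L(i))-c(L(i+1)))}},$$ where $L(i)$ is the box of $L$ containing $i$, $s_iL$ is $L$ with the entries $i,i+1$ interchanged, and $v_{s_iL}=0$ if $s_iL$ is not standard. The natural basis of $\tilde H^{(c,\lambda/\mu)}$ is $\{n_L\}$ with $n_L=T_wv_C$, where $w\in S_n$ is the permutation such that $L=wC$. *)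

(* Defs.v *)
From HB Require Import structures.
From mathcomp Require Import all_boot all_order all_algebra all_fingroup.
From mathcomp Require Import all_classical all_reals all_analysis.
From mathcomp Require Import complex zify.

Set Implicit Arguments.
Unset Strict Implicit.
Unset Printing Implicit Defensive.

Import Order.TTheory GRing.Theory Num.Theory.

Local Open Scope ring_scope.
Local Open Scope complex_scope.

(* Indices start at 0: 'I_n.-1 indexes T_1, ..., T_{n-1} and 'I_n indexes
   x_1, ..., x_n, the entries of tableaux and the points moved by S_n.  The
   generator indexed by i exchanges [lo i] (value i) and [hi i] (value i + 1). *)

Lemma lo_subproof n (i : 'I_n.-1) : (i < n)%N.
Proof. exact: leq_trans (ltn_ord i) (leq_pred n). Qed.

Lemma hi_subproof n (i : 'I_n.-1) : (i.+1 < n)%N.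
Proof. by rewrite -ltn_predRL. Qed.

Definition lo n (i : 'I_n.-1) : 'I_n := Ordinal (lo_subproof i).
Definition hi n (i : 'I_n.-1) : 'I_n := Ordinal (hi_subproof i).
Definition strans n (i : 'I_n.-1) : 'S_n := tperm (lo i) (hi i).

(** * Words and reduced words in S_n *)

(* The composite s_{i_1} o ... o s_{i_p}.  The product of permutations in the
   library is the opposite one, (s * t) x = t (s x), hence the order below. *)
Fixpoint word_perm n (u : seq 'I_n.-1) : 'S_n :=
  if u is i :: u' then (word_perm u' * strans i)%g else 1%g.

Definition reduced_word n (w : 'S_n) (u : seq 'I_n.-1) : Prop :=
  word_perm u = w /\
  forall u' : seq 'I_n.-1, word_perm u' = w -> (size u <= size u')%N.

(** * The affine Hecke algebra *)

Section AffineHecke.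
Variables (K : fieldType) (q : K) (n : nat).

Definition xmon (B : unitAlgType K) (y : 'I_n -> B) (g : 'I_n -> int) : B :=
  \prod_(k < n) y k ^ g k.

Definition sgamma (i : 'I_n.-1) (g : 'I_n -> int) : 'I_n -> int :=
  fun k => g (strans i k).

Definition set_lohi (i : 'I_n.-1) (g : 'I_n -> int) (a b : int) : 'I_n -> int :=
  fun k => if k == lo i then a else if k == hi i then b else g k.

(* The Laurent polynomial
     (x^g - x^{s_i g}) x_{i+1} / (x_{i+1} - x_i),
   with the geometric sum expanded; see [xquotP]. *)
Definition xquot (B : unitAlgType K) (y : 'I_n -> B)
    (i : 'I_n.-1) (g : 'I_n -> int) : B :=
  let a := g (lo i) in let b := g (hi i) in
  (if a <= b then 1 else -1) *
  \sum_(k < `|b - a|%N)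
    xmon y (set_lohi i g (Num.min a b + k%:Z) (Num.max a b - k%:Z)).

Definition affine_hecke_relations (B : unitAlgType K)
    (t : 'I_n.-1 -> B) (y : 'I_n -> B) : Prop :=
  [/\ (forall i, y i \is a GRing.unit) /\
        (forall i j, y i * y j = y j * y i),
      forall i j : 'I_n.-1, (i.+1 < j)%N -> t i * t j = t j * t i,
      forall i j : 'I_n.-1, j = i.+1 :> nat ->
        t i * t j * t i = t j * t i * t j,
      forall i, t i * t i = (q - q^-1) *: t i + 1 &
      forall i (g : 'I_n -> int),
        xmon y g * t i =
          t i * xmon y (sgamma i g) + (q - q^-1) *: xquot y i g].

(* A is the algebra presented by the generators T_i, x_j^{+-1} and the
   relations above. *)
Definition is_affine_hecke_algebra (A : unitAlgType K)
    (T : 'I_n.-1 -> A) (x : 'I_n -> A) : Prop :=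
  affine_hecke_relations T x /\
  forall (B : unitAlgType K) (t : 'I_n.-1 -> B) (y : 'I_n -> B),
    affine_hecke_relations t y ->
    exists f : {lrmorphism A -> B},
      [/\ forall i, f (T i) = t i, forall j, f (x j) = y j &
        forall f' : {lrmorphism A -> B},
          (forall i, f' (T i) = t i) -> (forall j, f' (x j) = y j) ->
          f' =1 f].

(* Every w has a reduced word and, by the braid relations, the product does
   not depend on it; the default value [::] is never used. *)
Definition Tw (A : unitAlgType K) (T : 'I_n.-1 -> A) (w : 'S_n) : A :=
  \prod_(i <- xget [::] [set u | reduced_word w u]%classic) T i.

End AffineHecke.

Section XquotP.
Variables (K : fieldType) (n : nat) (B : unitAlgType K) (y : 'I_n -> B).
Hypothesis y_unit : forall i, y i \is a GRing.unit.
Hypothesis y_comm : forall i j, y i * y j = y j * y i.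

Lemma prod_mulr (r : seq 'I_n) (g : 'I_n -> int) (j : 'I_n) :
  uniq r -> j \in r ->
  (\prod_(k <- r) y k ^ g k) * y j =
    \prod_(k <- r) y k ^ (g k + (k == j)%:Z).
Proof.
elim: r => [//|k r IHr] /= /andP[kr ur]; rewrite inE !big_cons.
have [jk _|jk /= jr] := eqVneq j k; last first.
  by rewrite addr0 -mulrA IHr.
rewrite -{k}jk in kr *.
have -> : \prod_(i <- r) y i ^ (g i + (i == j)%:Z) = \prod_(i <- r) y i ^ g i.
  apply: eq_big_seq => i ir; case: eqVneq => [ij|]; last by rewrite addr0.
  by move: kr; rewrite -ij ir.
have cj : GRing.comm (y j) (\prod_(i <- r) y i ^ g i).
  by apply: commr_prod => i _; apply: commrXz; exact: y_comm.
by rewrite -mulrA -cj mulrA exprzDr ?y_unit // expr1z.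
Qed.

Lemma xmon_mulr (g : 'I_n -> int) (j : 'I_n) :
  xmon y g * y j = xmon y (fun k => g k + (k == j)%:Z).
Proof. by rewrite /xmon prod_mulr ?index_enum_uniq ?mem_index_enum. Qed.

Lemma eq_xmon (g h : 'I_n -> int) : g =1 h -> xmon y g = xmon y h.
Proof. by move=> gh; apply: eq_bigr => k _; rewrite gh. Qed.

Lemma xquotP (i : 'I_n.-1) (g : 'I_n -> int) :
  xquot y i g * (y (hi i) - y (lo i)) =
    (xmon y g - xmon y (sgamma i g)) * y (hi i).
Proof.
have lohi : (hi i == lo i) = false by apply/eqP => /(congr1 val) /= /esym; exact: n_Sn.
rewrite /xquot /=; set a := g (lo i); set b := g (hi i).
pose m := Num.min a b; pose M := Num.max a b.
have dE : (`|b - a|%N)%:Z = M - m.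
  rewrite /m /M abszE; case: (leP a b) => ab; first by rewrite ger0_norm ?subr_ge0.
  by rewrite ltr0_norm ?subr_lt0 // opprB.
pose w (k : nat) := xmon y (set_lohi i g (m + k%:Z) (M + 1 - k%:Z)).
rewrite -mulrA mulr_suml.
rewrite (eq_bigr (fun k : 'I__ => - (w k.+1 - w k))); last first.
  move=> k _; rewrite mulrBr !xmon_mulr opprB /w; congr (_ - _);
    apply: eq_xmon => j; rewrite /set_lohi.
    have [e|_] := eqVneq j (lo i); first by rewrite e eq_sym lohi addr0.
    have [_|_] := eqVneq j (hi i); last by rewrite addr0.
    by rewrite addrAC.
  have [e|_] := eqVneq j (lo i); first by rewrite -addrA -PoszD addn1.
  have [_|_] := eqVneq j (hi i); rewrite addr0 //.
  by rewrite -addn1 PoszD opprD addrACA subrr addr0.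
rewrite sumrN -(big_mkord xpredT (fun k => w k.+1 - w k)) telescope_sumr //.
rewrite opprB /w addr0 subr0 dE.
have -> : m + (M - m) = M by rewrite addrC subrK.
have -> : M + 1 - (M - m) = m + 1 by rewrite opprB addrAC addrCA subrr addr0 addrC.
rewrite mulrBl !xmon_mulr /m /M.
have gE : xmon y (set_lohi i g a (b + 1))
          = xmon y (fun k => g k + (k == hi i)%:Z).
  apply: eq_xmon => j; rewrite /set_lohi.
  have [->|_] := eqVneq j (lo i); first by rewrite eq_sym lohi addr0.
  by have [->|_] := eqVneq j (hi i); rewrite ?addr0.
have sE : xmon y (set_lohi i g b (a + 1))
          = xmon y (fun k => sgamma i g k + (k == hi i)%:Z).
  apply: eq_xmon => j; rewrite /set_lohi /sgamma /strans.
  have [->|jl] := eqVneq j (lo i); first by rewrite tpermL eq_sym lohi addr0.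
  have [->|jh] := eqVneq j (hi i); first by rewrite tpermR.
  by rewrite tpermD 1?eq_sym // addr0.
case: (leP a b) => ab; first by rewrite mul1r gE sE.
by rewrite mulN1r opprB gE sE.
Qed.

End XquotP.

(** * Skew shapes and tableaux *)

Definition is_partition (lam : seq nat) : bool :=
  sorted geq lam && (0%N \notin lam).

Definition subpartition (mu lam : seq nat) : Prop :=
  forall r : nat, (nth 0 mu r <= nth 0 lam r)%N.

(* The boxes of lam / mu, as pairs (row, column) counted from 0. *)
Definition skew_box (lam mu : seq nat) : Type :=
  {p : 'I_(size lam) * 'I_(head 0%N lam) |
    (nth 0 mu p.1 <= p.2)%N && (p.2 < nth 0 lam p.1)%N}.
HB.instance Definition _ lam mu := Finite.on (skew_box lam mu).

Section Tableaux.
Variables lam mu : seq nat.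
Local Notation box := (skew_box lam mu).

Definition nboxes : nat := #|{: box}|.
Local Notation n := nboxes.

Definition row (b : box) : nat := (val b).1.
Definition col (b : box) : nat := (val b).2.
Definition diag (b : box) : int := (col b)%:Z - (row b)%:Z.

Definition diag_le (b b' : box) : bool :=
  (diag b < diag b') || ((diag b == diag b') && (row b <= row b')%N).
Definition box_ (i : 'I_n) : box :=
  tnth (sort_tuple diag_le (enum_tuple {: box})) i.

(* A filling of the boxes is encoded by the bijection sending an entry i to
   the box L(i) containing it. *)
Definition standard (L : {ffun 'I_n -> box}) : bool :=
  [&& injectiveb L, [forall b, b \in codom L] &
    [forall i, forall j,
      ((row (L i) == row (L j)) && (col (L i) < col (L j))%N
       || (col (L i) == col (L j)) && (row (L i) < row (L j))%N) ==>
      (i < j)%N]].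

Definition std_tab : Type := {L : {ffun 'I_n -> box} | standard L}.
HB.instance Definition _ := Finite.on std_tab.

(* wL: the entry i of L is replaced with w i. *)
Definition act_tab (w : 'S_n) (L : {ffun 'I_n -> box}) :
  {ffun 'I_n -> box} := [ffun i => L ((w^-1)%g i)].

(* Columns of different connected components are disjoint, and those of a
   component lie to the left of those of every component northeast of it, so
   that the column reading runs through all columns from left to right. *)
Definition col_le (b b' : box) : bool :=
  (col b < col b')%N || ((col b == col b') && (row b <= row b')%N).
Definition col_reading : {ffun 'I_n -> box} :=
  [ffun i => tnth (sort_tuple col_le (enum_tuple {: box})) i].

Lemma col_reading_standard : standard col_reading.
Proof.
set s := sort_tuple col_le (enum_tuple {: box}).
have us : uniq s by rewrite sort_uniq enum_uniq.
have Cinj : injective col_reading.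
  by move=> i j; rewrite !ffunE => /tuple_uniqP; apply.
apply/and3P; split; first exact/injectiveP.
  apply/forallP => b; have : b \in s by rewrite mem_sort mem_enum.
  by case/tnthP => i ->; rewrite -[tnth _ _]ffunE codom_f.
apply/forallP => i; apply/forallP => j; apply/implyP => ij.
rewrite ltnNge; apply/negP => ji.
have : col_le (tnth s j) (tnth s i).
  have b0 := tnth s i; rewrite !(tnth_nth b0).
  apply: sorted_leq_nth => //; rewrite ?inE ?size_tuple ?ltn_ord //.
  - by move=> x y z; rewrite /col_le; lia.
  - by move=> x; rewrite /col_le; lia.
  - by apply: sort_sorted => x y; rewrite /col_le; lia.
by move: ij; rewrite !ffunE /col_le -/s; lia.
Qed.

Definition C_tab : std_tab := Sub col_reading col_reading_standard.

(* The permutation w with L = w C. *)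
Definition tab_perm (L : std_tab) : 'S_n :=
  odflt 1%g [pick w : 'S_n | val L == act_tab w col_reading].

End Tableaux.

(** * Placed skew shapes *)

Section Placed.
Variable R : realType.
Local Notation CC := R[i].

Definition cexp (z : CC) : CC :=
  (expR (complex.Re z))%:C * (cos (complex.Im z) +i* sin (complex.Im z)).

(* q^{2z} = e^{ln(q^2) z}, where ell is a logarithm of q^2. *)
Definition q2pow (ell z : CC) : CC := cexp (ell * z).

(* R + i[0, 2 pi / ell), where [0, 2 pi / ell) is the half-open segment of the
   complex plane with these endpoints, an interval of real numbers when ell is
   a positive real number. *)
Definition strip (ell z : CC) : Prop :=
  exists a t : R, 0 <= t < 1 /\ z = a%:C + 'i * (t%:C * ((2 * pi)%:C / ell)).

Lemma strip_real (l : R) (z : CC) : 0 < l ->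
  strip l%:C z <-> 0 <= complex.Im z < 2 * pi / l.
Proof.
move=> l0; have p0 : 0 < 2 * pi / l by rewrite divr_gt0 // mulr_gt0 // pi_gt0.
have lE : (2 * pi)%:C / l%:C = (2 * pi / l)%:C by rewrite [RHS]rmorphM /= fmorphV.
split=> [[a [t [t01 ->]]]|]; rewrite ?/strip lE.
  by simpc; rewrite pmulr_lge0 // gtr_pMl.
case: z => a b /= /andP[b0 b1]; exists a, (b / (2 * pi / l)).
split; first by rewrite (divr_ge0 b0 (ltW p0)) ltr_pdivrMr // mul1r.
by rewrite -rmorphM divfK ?gt_eqF //; simpc.
Qed.

(* The order of R[i] is the partial one: z <= z' holds when z' - z is a
   nonnegative real number. *)
Definition placed (ell : CC) (lam mu : seq nat) (c : skew_box lam mu -> CC) :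
    Prop :=
  [/\ forall b, strip ell (c b),
      forall i j : 'I_(nboxes lam mu), (i < j)%N ->
        (exists m : int, c (box_ j) - c (box_ i) = m%:~R) ->
        c (box_ i) <= c (box_ j),
      forall i j : 'I_(nboxes lam mu),
        c (box_ j) = c (box_ i) + 1 <->
        diag (box_ j) = diag (box_ i) + 1 &
      forall i j : 'I_(nboxes lam mu),
        c (box_ i) = c (box_ j) <-> diag (box_ i) = diag (box_ j)].

Section Module.
Variables (q ell : CC) (lam mu : seq nat) (c : skew_box lam mu -> CC).
Local Notation n := (nboxes lam mu).
Local Notation tab := (std_tab lam mu).
Variables (A : unitAlgType CC) (T : 'I_n.-1 -> A) (x : 'I_n -> A).
Variable M : lmodType A.

Definition Tdiag (i : 'I_n.-1) (L : tab) : CC :=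
  (q - q^-1) / (1 - q2pow ell (c (val L (lo i)) - c (val L (hi i)))).

(* v_L, extended by 0 to the fillings L that are not standard. *)
Definition vext (v : tab -> M) (L : {ffun 'I_n -> skew_box lam mu}) : M :=
  oapp v 0 (insub L).

(* The scalar a : CC acts on an A-module through a%:A = a *: 1. *)
Definition is_skew_module (v : tab -> M) : Prop :=
  [/\ forall m : M, exists! a : {ffun tab -> CC},
        m = \sum_(L : tab) (a L)%:A *: v L,
      forall (i : 'I_n) (L : tab),
        x i *: v L = (q2pow ell (c (val L i)))%:A *: v L &
      forall (i : 'I_n.-1) (L : tab),
        T i *: v L = (Tdiag i L)%:A *: v L
          + (q^-1 + Tdiag i L)%:A *: vext v (act_tab (strans i) (val L))].

Definition nvec (v : tab -> M) (L : tab) : M :=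
  Tw T (tab_perm L) *: v (C_tab lam mu).

End Module.

(* z belongs to the subring Z[q, q^-1] of the complex numbers. *)
Definition in_Zqq (q z : CC) : Prop :=
  exists (p : {poly int}) (k : nat),
    z = (map_poly (intr : int -> CC) p).[q] / q ^+ k.

End Placed.

(* Main.v *)
(* Write F_u = T_u v_C ([Tvec u] below) for every permutation u, so that n_L = F_u
   if L = uC; both claims follow once every F_u lies in the span of the n_L over
   Z[q, q^-1].  This is proved by induction on the length of u.  If uC is not standard because
   of two consecutive boxes of a column, then u = u' s_l with u' shorter and T_l
   acts on v_C by - q^-1.  Otherwise two adjacent boxes of a row, numbered a < b
   in C, are out of order.  Let S be the symmetric group of the segment [a, b],
   which meets two columns only, and let D be the set of its elements increasing
   on these columns.  The vector Y = sum_(d in D) (-q)^(- l(d)) F_d is zero: all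
   T_l, s_l in S, act on Y by - q^-1, which forces its coordinates on the standard
   tableaux gC, g in S, to be all zero or all nonzero, and one of them vanishes as
   it belongs to a tableau with two consecutive entries in a row.  Now u = u'd with
   u' increasing on [a, b] and d the longest element of D, and T_u' Y = 0 expresses
   F_u through shorter permutations.  For x_i, move x-monomials through T_u, whose
   commutation relations have coefficients in Z[q, q^-1], up to v_C. *)

Require Import Defs.
From mathcomp Require Import all_boot all_order all_algebra all_fingroup.
From mathcomp Require Import all_classical all_reals all_analysis.
From mathcomp Require Import complex zify ring.

Set Implicit Arguments.
Unset Strict Implicit.
Unset Printing Implicit Defensive.

Import Order.TTheory GRing.Theory Num.Theory.

Local Open Scope ring_scope.
Local Open Scope complex_scope.

(** * Inversions, lengths and reduced words in the symmetric group *)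

Section Inversions.
Variable n : nat.
Implicit Types (w u : 'S_n) (l i j : 'I_n.-1) (x y : 'I_n).

Definition inv_set w : {set 'I_n * 'I_n} :=
  [set p : 'I_n * 'I_n | (p.1 < p.2)%N && (w p.2 < w p.1)%N].
Definition len w : nat := #|inv_set w|.

Lemma in_inv_set w x y :
  ((x, y) \in inv_set w) = (x < y)%N && (w y < w x)%N.
Proof. by rewrite inE. Qed.

Lemma stransE l x : nat_of_ord (strans l x) =
  if x == l :> nat then l.+1 else if x == l.+1 :> nat then nat_of_ord l else x.
Proof.
rewrite /strans; case: tpermP => [->|->|/eqP + /eqP] /=; rewrite ?eqxx //.
  by case: eqP => //; lia.
by rewrite -!val_eqE /= => /negbTE-> /negbTE->.
Qed.

Lemma stransP l x : [\/ x = l :> nat /\ strans l x = l.+1 :> nat,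
  x = l.+1 :> nat /\ strans l x = l :> nat |
  x <> l :> nat /\ x <> l.+1 :> nat /\ strans l x = x].
Proof.
rewrite /strans; case: tpermP => [->|->|xl xh].
- by apply: Or31.
- by apply: Or32.
- by apply: Or33; split=> [/(@val_inj _ _ _ x (lo l))|] //; split=> // /(@val_inj _ _ _ x (hi l)).
Qed.

Lemma strans_mono l x y : (x < y)%N -> ~ (x = l :> nat /\ y = l.+1 :> nat) ->
  (strans l x < strans l y)%N.
Proof.
move=> xy Nlh; case: (stransP l x) => [[? ?]|[? ?]|[? [? e]]]; rewrite ?{}e;
  by case: (stransP l y) => [[? ?]|[? ?]|[? [? e]]]; rewrite ?{}e; lia.
Qed.

Lemma stransK l : (strans l * strans l = 1)%g.
Proof. by rewrite /strans tperm2. Qed.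

Lemma strans_mulK l w : (w * strans l * strans l = w)%g.
Proof. by rewrite -mulgA stransK mulg1. Qed.

Lemma stransV l : ((strans l)^-1 = strans l)%g.
Proof. exact: tpermV. Qed.

Lemma strans_lo l : strans l (lo l) = hi l. Proof. exact: tpermL. Qed.
Lemma strans_hi l : strans l (hi l) = lo l. Proof. exact: tpermR. Qed.

Lemma strans_invol l : involutive (strans l).
Proof. by move=> x; rewrite -permM stransK perm1. Qed.

Lemma perm_val_neq w x y : x <> y :> nat -> nat_of_ord (w x) <> nat_of_ord (w y).
Proof. by move=> xy /val_inj /perm_inj /(congr1 val). Qed.

(** Applying s_l to both members of a pair carries the inversions of [w] to those of [strans l * w]
    other than [(lo l, hi l)], which is the one new inversion. *)
Lemma len_strans_mul l w : (w (lo l) < w (hi l))%N ->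
  len (strans l * w)%g = (len w).+1.
Proof.
move=> lh; pose f (p : 'I_n * 'I_n) := (strans l p.1, strans l p.2).
have fK : involutive f by case=> x y; rewrite /f /= !strans_invol.
have -> : len (strans l * w)%g = #|(lo l, hi l) |: f @: inv_set w|.
  apply: eq_card => -[x y]; rewrite in_setU1 -[in RHS](fK (x, y)).
  rewrite (mem_imset _ _ (can_inj fK)) fK /f /= !in_inv_set !permM xpair_eqE -!val_eqE /=.
  have [[xl yh]|Nlh] := pselect (x = l :> nat /\ y = l.+1 :> nat).
    have -> : x = lo l by exact: val_inj.
    have -> : y = hi l by exact: val_inj.
    by rewrite strans_lo strans_hi !eqxx /= lh ltnS leqnn.
  have [[xh yl]|Nhl] := pselect (x = l.+1 :> nat /\ y = l :> nat).
    have -> : x = hi l by exact: val_inj.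
    have -> : y = lo l by exact: val_inj.
    by rewrite strans_lo strans_hi /=; lia.
  have := stransE l x; have := stransE l y.
  move: (w (strans l x)) (w (strans l y)) => wx wy.
  by case: (x == l :> nat) / eqP => ?; case: (y == l :> nat) / eqP => ?;
    case: (x == l.+1 :> nat) / eqP => ?; case: (y == l.+1 :> nat) / eqP => ?;
    move=> /=; lia.
rewrite cardsU1 (card_imset _ (can_inj fK)) -{1}(fK (lo l, hi l)).
rewrite (mem_imset _ _ (can_inj fK)) /f /= in_inv_set.
by rewrite strans_lo strans_hi /=; rewrite ltnNge leqnSn.
Qed.

Lemma lenV w : len w^-1%g = len w.
Proof.
pose f (p : 'I_n * 'I_n) := (w p.2, w p.1).
have f_inj : injective f by move=> [x y] [x' y'] [] /perm_inj -> /perm_inj ->.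
rewrite -[RHS](card_imset _ f_inj); apply: eq_card => -[x y].
have -> : (x, y) = f (w^-1%g y, w^-1%g x) by rewrite /f /= !permKV.
by rewrite (mem_imset _ _ f_inj) !in_inv_set !permK !permKV andbC.
Qed.

Lemma len_mul_strans i w : (w^-1%g (lo i) < w^-1%g (hi i))%N ->
  len (w * strans i)%g = (len w).+1.
Proof. by move=> lh; rewrite -lenV invMg stransV (len_strans_mul lh) lenV. Qed.

Lemma lohi_dec w l : (w (lo l) < w (hi l))%N \/ (w (hi l) < w (lo l))%N.
Proof. by have := @perm_val_neq w (lo l) (hi l); rewrite /=; lia. Qed.

Lemma len_strans_mul_desc l w : (w (hi l) < w (lo l))%N ->
  len w = (len (strans l * w)%g).+1.
Proof.
move=> hl; rewrite -(@len_strans_mul l) ?mulgA ?stransK ?mul1g //.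
by rewrite !permM strans_lo strans_hi.
Qed.

Lemma len_mul_strans_desc i w : (w^-1%g (hi i) < w^-1%g (lo i))%N ->
  len w = (len (w * strans i)%g).+1.
Proof.
by move=> hl; rewrite -lenV (len_strans_mul_desc hl) -lenV invMg stransV invgK.
Qed.

Lemma increasing_adjacent w x y : (x < y)%N ->
  (forall l, (x <= l)%N -> (l < y)%N -> (w (lo l) < w (hi l))%N) -> (w x < w y)%N.
Proof.
case: y => y yn /=; elim: y yn => // y IHy yn xy adj.
have yn1 : (y < n.-1)%N by lia.
have -> : Ordinal yn = hi (Ordinal yn1) by exact: val_inj.
have wy := adj (Ordinal yn1) xy (leqnn _).
have loE : lo (Ordinal yn1) = Ordinal (ltnW yn) by exact: val_inj.
have [xy'|yx] := ltnP x y.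
  apply: leq_trans wy; rewrite ltnS loE; apply/ltnW/IHy => // l xl ly.
  by apply: adj => //; lia.
suff -> : x = lo (Ordinal yn1) by [].
by apply: val_inj => /=; lia.
Qed.

(** An increasing map sends every point to one at least as large; this is applied to [w] and to its
    inverse. *)
Lemma increasing_perm_eq1 w :
  (forall x y, (x < y)%N -> (w x < w y)%N) -> w = 1%g.
Proof.
move=> wi.
have ge u : (forall x y, (x < y)%N -> (u x < u y)%N) -> forall x, (x <= u x)%N.
  move=> ui [x xn] /=; elim: x xn => // x IHx xn.
  by apply: leq_ltn_trans (IHx (ltnW xn)) (ui _ _ _) => /=.
have wVi x y : (x < y)%N -> (w^-1%g x < w^-1%g y)%N.
  move=> xy; rewrite ltnNge leq_eqVlt; apply/norP; split.
    by apply/eqP/perm_val_neq; lia.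
  by apply/negP => /wi; rewrite !permKV; lia.
apply/permP => x; rewrite perm1; apply/val_inj/eqP; rewrite eqn_leq ge // andbT.
by have := ge _ wVi (w x); rewrite permK.
Qed.

(** If the inversions agree, [u] after the inverse of [w] preserves the order, hence is the
    identity. *)
Lemma inv_set_inj : injective inv_set.
Proof.
move=> w u wu; have inc : (w^-1 * u = 1)%g.
  apply: increasing_perm_eq1 => x y xy; rewrite !permM.
  move: wu => /setP wu.
  have := @perm_val_neq (w^-1 * u)%g x y; have := @perm_val_neq w^-1%g x y.
  have := wu (w^-1%g x, w^-1%g y); have := wu (w^-1%g y, w^-1%g x).
  rewrite !permM !in_inv_set !permKV.
  move: (w^-1%g x) (w^-1%g y) => a b.
  move: (u a) (u b) => a' b'. have xy' : x <> y :> nat by lia.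
  rewrite xy => ba ab /(_ xy') ? /(_ xy') ?; move: ba ab.
  by case: (ltngtP a b) => ?; case: (ltngtP a' b') => ? //; lia.
by rewrite -[w]mulg1 -inc mulKVg.
Qed.

Lemma exists_descent w : w != 1%g -> exists l, (w (hi l) < w (lo l))%N.
Proof.
move=> /eqP w1; apply: contrapT => Nl; apply: w1.
apply: increasing_perm_eq1 => x y xy; apply: increasing_adjacent => // l _ _.
by have [//|hl] := lohi_dec w l; case: Nl; exists l.
Qed.

Lemma exists_left_descent w :
  w != 1%g -> exists i, (w^-1%g (hi i) < w^-1%g (lo i))%N.
Proof. by rewrite -invg_eq1 => /exists_descent. Qed.

Lemma len1 : len 1%g = 0%N.
Proof. by apply: eq_card0 => -[x y]; rewrite in_inv_set !perm1 inE; lia. Qed.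

Lemma word_perm_cat (r s : seq 'I_n.-1) :
  word_perm (r ++ s) = (word_perm s * word_perm r)%g.
Proof. by elim: r => [|i r IH] /=; rewrite ?mulg1 // IH mulgA. Qed.

Lemma len_word_perm (r : seq 'I_n.-1) : (len (word_perm r) <= size r)%N.
Proof.
elim: r => [|i r IH] /=; first by rewrite len1.
have [lh|hl] := lohi_dec (word_perm r)^-1%g i.
  by rewrite len_mul_strans.
by have := len_mul_strans_desc hl; lia.
Qed.

Lemma exists_word w : exists2 r, word_perm r = w & size r = len w.
Proof.
move: {2}(len w) (erefl (len w)) => k; elim: k w => [|k IH] w wk;
    have [->|w1] := eqVneq w 1%g; try by exists [::]; rewrite ?len1.
  by have [i /len_mul_strans_desc] := exists_left_descent w1; rewrite wk.
have [i hl] := exists_left_descent w1; have wE := len_mul_strans_desc hl.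
have [|r rw rk] := IH (w * strans i)%g; first by move: wE; rewrite wk => -[].
by exists (i :: r); rewrite /= ?rk ?wE // rw -mulgA stransK mulg1.
Qed.

(** Words of length [len w] exist by stripping left descents, and none is shorter since a letter
    changes the number of inversions by one. Minimality of a word thus becomes a count of
    inversions. *)
Lemma reduced_wordP w (r : seq 'I_n.-1) :
  reduced_word w r <-> word_perm r = w /\ size r = len w.
Proof.
split=> -[rw].
  have [s sw sk] := exists_word w => /(_ s sw) rs; split => //.
  by apply/eqP; rewrite eqn_leq -{1}sk rs -rw len_word_perm.
by move=> rk; split=> // s sw; rewrite rk -sw len_word_perm.
Qed.

End Inversions.

(** * Permutations supported on a segment and the factorization along its cosets *)

Section Segments.
Variables (n : nat) (a b : 'I_n).
Implicit Types (g u d : 'S_n) (x y : 'I_n).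

Definition seg : {set 'I_n} := [set x : 'I_n | (a <= x)%N && (x <= b)%N].

Lemma in_seg x : (x \in seg) = (a <= x)%N && (x <= b)%N.
Proof. by rewrite inE. Qed.

Definition increasing_on (S : {set 'I_n}) u : Prop :=
  forall x y, x \in S -> y \in S -> (x < y)%N -> (u x < u y)%N.

Lemma perm_on_segP g x : perm_on seg g ->
  x \in seg /\ g x \in seg \/ x \notin seg /\ g x = x.
Proof.
move=> gS; have := perm_closed x gS; case xS: (x \in seg) => gx; first by left.
by right; rewrite (out_perm gS) ?xS.
Qed.

(** A point outside the segment lies on the same side of all its points, so moving points within the
    segment changes no comparison with it. *)
Lemma perm_on_seg_mono g x y : perm_on seg g -> ~~ ((x \in seg) && (y \in seg)) ->
  (x < y)%N -> (g x < g y)%N.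
Proof.
move=> gS; case: (perm_on_segP x gS) => [[xS gx]|[xS ->]];
  case: (perm_on_segP y gS) => [[yS gy]|[yS ->]]; rewrite ?xS ?yS //;
  by move: xS yS; try move: gx; try move: gy; rewrite !in_seg; lia.
Qed.

Lemma seg_descent g (l : 'I_n.-1) : perm_on seg g -> (g (hi l) < g (lo l))%N ->
  lo l \in seg /\ hi l \in seg.
Proof.
move=> gS hl; apply/andP/negPn/negP => /(perm_on_seg_mono gS) /(_ (leqnn _)).
by rewrite ltnNge (ltnW hl).
Qed.

Lemma perm_on_strans (l : 'I_n.-1) : lo l \in seg -> hi l \in seg ->
  perm_on seg (strans l).
Proof.
move=> ll hl; apply/fintype.subsetP => x; rewrite inE /strans.
by case: tpermP => [->|->|]; rewrite ?eqxx.
Qed.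

Lemma perm_on_segV g : perm_on seg g -> perm_on seg g^-1%g.
Proof.
move=> gS; apply/fintype.subsetP => x; rewrite inE; apply: contraR => xS.
by apply/eqP/(@perm_inj _ g); rewrite permKV (out_perm gS).
Qed.

(** Here [u] is the shortest element of its coset. Descents are peeled off [g] one at a time; each
    is also a descent of [g * u], because [u] preserves the order of the values that [g] takes in
    the segment. *)
Lemma len_mul_seg g u : perm_on seg g -> increasing_on seg u ->
  len (g * u)%g = (len u + len g)%N.
Proof.
move: {2}(len g) (erefl (len g)) => k.
elim: k g => [|k IH] g gk gS uS; have [->|g1] := eqVneq g 1%g;
  rewrite ?mul1g ?len1 ?addn0 //.
  by have [l /len_strans_mul_desc] := exists_descent g1; rewrite gk.
have [l hl] := exists_descent g1; have gE := len_strans_mul_desc hl.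
have [ll lh] := seg_descent gS hl.
rewrite gE addnS -IH; last 3 first.
- by move: gE; rewrite gk => -[].
- by rewrite perm_onM ?perm_on_strans.
- by [].
rewrite -mulgA; apply: len_strans_mul_desc.
by rewrite !permM; apply: uS; rewrite ?perm_closed.
Qed.

(** Descents inside the segment are removed while there are any, which shortens the permutation;
    what remains increases on the segment. *)
Lemma exists_seg_factor u :
  exists d u', [/\ perm_on seg d, u = (d * u')%g & increasing_on seg u'].
Proof.
move: {2}(len u) (leqnn (len u)) => k; elim: k u => [|k IH] u uk.
  exists 1%g, u; split; rewrite ?perm_on1 ?mul1g // => x y _ _ xy.
  apply: increasing_adjacent => // l _ _; case: (lohi_dec u l) => // hl.
  by have := len_strans_mul_desc hl; lia.
have [[l [ll lh hl]]|Nl] :=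
    pselect (exists l : 'I_n.-1, [/\ lo l \in seg, hi l \in seg & (u (hi l) < u (lo l))%N]).
  have uE := len_strans_mul_desc hl.
  have [|d [u' [dS du uS]]] := IH (strans l * u)%g; first by lia.
  exists (strans l * d)%g, u'; split=> //; first by rewrite perm_onM ?perm_on_strans.
  by rewrite -mulgA -du mulgA stransK mul1g.
exists 1%g, u; split; rewrite ?perm_on1 ?mul1g // => x y xS yS xy.
apply: increasing_adjacent => // l xl ly; case: (lohi_dec u l) => // hl.
by case: Nl; exists l; split => //; move: xS yS; rewrite !in_seg /=; lia.
Qed.

End Segments.

(** * Independence of the product of generators from the reduced word *)

Section HeckeWords.
Variables (n : nat) (A : pzRingType) (T : 'I_n.-1 -> A).
Hypothesis T_comm : forall i j : 'I_n.-1, (i.+1 < j)%N -> T i * T j = T j * T i.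
Hypothesis T_braid : forall i j : 'I_n.-1, j = i.+1 :> nat ->
  T i * T j * T i = T j * T i * T j.
Implicit Types (w : 'S_n) (i j : 'I_n.-1) (r s : seq 'I_n.-1).

Lemma strans_comm i j : (i.+1 < j)%N -> (strans i * strans j = strans j * strans i)%g.
Proof.
move=> ij; apply/permP => x; apply: ord_inj; rewrite !permM /=.
have := stransP i (strans j x); have := stransP j (strans i x).
have := stransP i x; have := stransP j x.
do 4![case=> [[? ?]|[? ?]|[? [? e]]] //=; rewrite ?{}e]; lia.
Qed.

Lemma strans_braid i j : j = i.+1 :> nat ->
  (strans i * strans j * strans i = strans j * strans i * strans j)%g.
Proof.
move=> ij; apply/permP => x; apply: ord_inj; rewrite !permM /=.
have := stransP i (strans j (strans i x)); have := stransP j (strans i (strans j x)).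
have := stransP i (strans j x); have := stransP j (strans i x).
have := stransP i x; have := stransP j x.
by do 6![case=> [[? ?]|[? ?]|[? [? e]]] //=; rewrite ?{}e]; lia.
Qed.

Lemma reduced_cons i r : len (word_perm (i :: r)) = (size r).+1 ->
  len (word_perm r) = size r /\
  ((word_perm (i :: r))^-1%g (hi i) < (word_perm (i :: r))^-1%g (lo i))%N.
Proof.
move=> ir; have rE : (word_perm (i :: r) * strans i)%g = word_perm r.
  by rewrite /= strans_mulK.
case: (lohi_dec (word_perm (i :: r))^-1%g i) => [/len_mul_strans|hl].
  by rewrite rE ir; have := len_word_perm r; lia.
by split=> //; have := len_mul_strans_desc hl; rewrite rE ir => -[].
Qed.

(** Matsumoto's theorem for the symmetric group, by induction on the length. If the first letters i
    and j differ, both are left descents, so there are reduced words whose beginnings are the two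
    sides of the relation between T_i and T_j; the induction hypothesis compares tails with
    these. *)
Lemma prod_reduced r s : word_perm r = word_perm s ->
  len (word_perm r) = size r -> size s = size r ->
  \prod_(i <- r) T i = \prod_(i <- s) T i.
Proof.
move: {2}(size r) (erefl (size r)) => k.
elim/ltn_ind: k r s => -[|k] IH; first by move=> [|//] [|//].
have lt_case i j r s : (i < j)%N -> word_perm (i :: r) = word_perm (j :: s) ->
    size r = k -> size s = k -> len (word_perm (i :: r)) = k.+1 ->
    \prod_(i <- i :: r) T i = \prod_(i <- j :: s) T i.
  move=> ij rs rk sk ek.
  have [er di] : len (word_perm r) = size r /\
      ((word_perm (i :: r))^-1%g (hi i) < (word_perm (i :: r))^-1%g (lo i))%N.
    by apply: reduced_cons; rewrite rk.
  have [es dj] : len (word_perm s) = size s /\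
      ((word_perm (j :: s))^-1%g (hi j) < (word_perm (j :: s))^-1%g (lo j))%N.
    by apply: reduced_cons; rewrite sk -rs.
  rewrite -rs in dj; set w := word_perm (i :: r) in rs ek di dj.
  have rE : word_perm r = (w * strans i)%g by rewrite /w /= strans_mulK.
  have sE : word_perm s = (w * strans j)%g by rewrite rs /= strans_mulK.
  clearbody w; have wi := len_mul_strans_desc di; rewrite !big_cons.
  have [ij1|] := ltnP i.+1 j.
    have wij : len (w * strans i)%g = (len (w * strans i * strans j)%g).+1.
      apply: len_mul_strans_desc; rewrite invMg stransV !permM.
      rewrite [strans i (hi j)]tpermD ?[strans i (lo j)]tpermD //;
        by rewrite -val_eqE /=; lia.
    (* The letters commute: [i :: j :: z] and [j :: i :: z] are two more reduced words of [w],
       linked by the commutation relation. *)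
    have [z zE zk] := exists_word (w * strans i * strans j)%g.
    have [k' kE] : exists k', k = k'.+1 by exists (size z); lia.
    rewrite (IH k (leqnn _) r (j :: z) rk _ er) /=; last 2 first.
    - by rewrite rE zE strans_mulK.
    - by lia.
    rewrite (IH k (leqnn _) s (i :: z) sk _ es) /=; last 2 first.
    - rewrite sE zE -[(w * _ * _)%g]mulgA strans_comm //.
      by rewrite mulgA strans_mulK.
    - by lia.
    by rewrite !big_cons !mulrA T_comm.
  move=> ji; have {ji} ji : j = i.+1 :> nat by lia.
  have loj : lo j = hi i by apply: val_inj => /=.
  have wij : len (w * strans i)%g = (len (w * strans i * strans j)%g).+1.
    apply: len_mul_strans_desc; rewrite invMg stransV !permM loj strans_hi.
    rewrite [strans i (hi j)]tpermD; try by rewrite -val_eqE /=; lia.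
    by apply: ltn_trans di; rewrite -loj.
  have wiji : len (w * strans i * strans j)%g =
      (len (w * strans i * strans j * strans i)%g).+1.
    apply: len_mul_strans_desc; rewrite !invMg !stransV !permM -loj strans_lo.
    rewrite [strans j (lo i)]tpermD; try by rewrite -val_eqE /=; lia.
    rewrite [strans i (hi j)]tpermD; try by rewrite -val_eqE /=; lia.
    by rewrite strans_lo -loj.
  (* The letters are adjacent: the intermediate words begin with [i, j, i] and [j, i, j] and both
     continue with [z]. *)
  have [z zE zk] := exists_word (w * strans i * strans j * strans i)%g.
  rewrite (IH k (leqnn _) r [:: j, i & z] rk _ er) /=; last 2 first.
  - by rewrite rE zE !strans_mulK.
  - by lia.
  rewrite (IH k (leqnn _) s [:: i, j & z] sk _ es) /=; last 2 first.
  - rewrite sE zE -[(w * strans i * _)%g]mulgA -[(w * _ * strans i)%g]mulgA.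
    rewrite (strans_braid ji) !mulgA.
    by rewrite !strans_mulK.
  - by lia.
  by rewrite !big_cons !mulrA T_braid.
move=> [//|i r] [//|j s] [rk] rs ek [sk]; have [er _] := reduced_cons ek.
have ek1 : len (word_perm (i :: r)) = k.+1 by rewrite ek /= rk.
have [ij|ji|ij] := ltngtP i j; first by apply: lt_case; rewrite ?sk.
  by apply/esym/lt_case; rewrite -?rs ?sk.
have {ij} ij : i = j by exact: val_inj.
rewrite -{j}ij in rs *; rewrite !big_cons; congr (_ * _).
have rs' : word_perm r = word_perm s by exact: mulIg rs.
exact: (IH k (leqnn _) r s rk rs' er sk).
Qed.

End HeckeWords.

(** * Multiplication rules for the elements T_w *)

Section HeckeBasis.
Variables (K : fieldType) (q : K) (n : nat) (A : unitAlgType K) (T : 'I_n.-1 -> A).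
Hypothesis T_comm : forall i j : 'I_n.-1, (i.+1 < j)%N -> T i * T j = T j * T i.
Hypothesis T_braid : forall i j : 'I_n.-1, j = i.+1 :> nat ->
  T i * T j * T i = T j * T i * T j.
Hypothesis T_quad : forall i, T i * T i = (q - q^-1) *: T i + 1.
Implicit Types (w u : 'S_n) (i l : 'I_n.-1) (r : seq 'I_n.-1).

Lemma Tw_word w r : word_perm r = w -> size r = len w ->
  Tw T w = \prod_(i <- r) T i.
Proof.
move=> rw rk; rewrite /Tw.
(* A reduced word exists, so [xget] returns one and not its default value. *)
set s := xget _ _; have : reduced_word w s.
  by apply: (@xgetPex _ [::] [set u | reduced_word w u]%classic); exists r; apply/reduced_wordP.
move/reduced_wordP => [sw sk].
by apply: (prod_reduced T_comm T_braid); rewrite ?sw ?rk ?sk.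
Qed.

(** Reduced words concatenate when lengths add up. The factors change places because the product of
    permutations is the opposite of composition. *)
Lemma Tw_mul w u : len (u * w)%g = (len w + len u)%N ->
  Tw T (u * w)%g = Tw T w * Tw T u.
Proof.
move=> uwE; have [r rw rk] := exists_word w; have [s su sk] := exists_word u.
rewrite (Tw_word rw rk) (Tw_word su sk) -big_cat; apply: Tw_word.
  by rewrite word_perm_cat rw su.
by rewrite size_cat rk sk.
Qed.

Lemma Tw1 : Tw T 1%g = 1.
Proof. by rewrite (@Tw_word _ [::]) ?big_nil ?len1. Qed.

Lemma Tw_strans i : Tw T (strans i) = T i.
Proof.
rewrite (@Tw_word _ [:: i]) /= ?big_seq1 ?mul1g //.
by rewrite -[strans i]mulg1 len_strans_mul ?len1 // !perm1.
Qed.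

Lemma len_strans i : len (strans i) = 1%N.
Proof. by rewrite -[strans i]mulg1 len_strans_mul ?len1 // !perm1. Qed.

Lemma T_mul_Tw i w : (w^-1%g (lo i) < w^-1%g (hi i))%N ->
  T i * Tw T w = Tw T (w * strans i)%g.
Proof.
by move=> /len_mul_strans wE; rewrite Tw_mul ?Tw_strans // wE len_strans.
Qed.

Lemma Tw_mul_T l w : (w (lo l) < w (hi l))%N ->
  Tw T w * T l = Tw T (strans l * w)%g.
Proof.
by move=> /len_strans_mul wE; rewrite Tw_mul ?Tw_strans // wE len_strans addn1.
Qed.

Lemma T_mul_Tw_desc i w : (w^-1%g (hi i) < w^-1%g (lo i))%N ->
  T i * Tw T w = Tw T (w * strans i)%g + (q - q^-1) *: Tw T w.
Proof.
move=> hl; have wE : T i * Tw T (w * strans i)%g = Tw T w.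
  rewrite T_mul_Tw ?strans_mulK // invMg stransV !permM.
  by rewrite strans_lo strans_hi.
by rewrite -{1}wE mulrA T_quad mulrDl mul1r -scalerAl wE addrC.
Qed.

End HeckeBasis.

(** * The column reading tableau and the standardness of its permuted fillings *)

Section ColumnReading.
(* The [row] and [col] of boxes are hidden by those of matrices. *)
Import Defs.
Variables lam mu : seq nat.
Local Notation box := (skew_box lam mu).
Local Notation n := (nboxes lam mu).
Local Notation C := (col_reading lam mu).
Implicit Types (b : box) (x y : 'I_n) (g u : 'S_n).

Definition precedes b b' : bool :=
  ((row b == row b') && (col b < col b')%N)
  || ((col b == col b') && (row b < row b')%N).

Lemma box_eq b b' : row b = row b' -> col b = col b' -> b = b'.
Proof.
move=> rE cE; apply: val_inj; case: b b' rE cE => [[i j] ?] [[i' j'] ?].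
by rewrite /row /col /= => /val_inj -> /val_inj ->.
Qed.

Lemma exists_box r s : is_partition lam ->
  (nth 0%N mu r <= s)%N -> (s < nth 0%N lam r)%N ->
  exists b, row b = r /\ col b = s.
Proof.
move=> /andP[slam _] ms sl.
have rl : (r < size lam)%N.
  by rewrite ltnNge; apply/negP => lr; move: sl; rewrite nth_default.
have sh : (s < head 0%N lam)%N.
  apply: leq_trans sl _; rewrite -nth0.
  have geqT : transitive geq by move=> i j k; rewrite /= => ij jk; apply: leq_trans jk ij.
  apply: (sorted_leq_nth geqT leqnn 0%N slam) => //; rewrite inE.
  exact: leq_ltn_trans rl.
have bP : (nth 0 mu (Ordinal rl, Ordinal sh).1 <= (Ordinal rl, Ordinal sh).2)%N
    && ((Ordinal rl, Ordinal sh).2 < nth 0 lam (Ordinal rl, Ordinal sh).1)%N.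
  by rewrite /= ms.
by exists (exist _ (Ordinal rl, Ordinal sh) bP).
Qed.

Lemma box_bounds b : (nth 0%N mu (row b) <= col b)%N /\ (col b < nth 0%N lam (row b))%N.
Proof. by apply/andP; exact: valP b. Qed.

Lemma C_inj : injective C.
Proof.
case/and3P: (col_reading_standard lam mu) => /injectiveP Cinj _ _; exact: Cinj.
Qed.

Lemma C_surj b : exists x, C x = b.
Proof.
case/and3P: (col_reading_standard lam mu) => _ /forallP /(_ b) /codomP [x ->] _.
by exists x.
Qed.

(** The reading is sorted and injective, so comparisons of entries turn into arithmetic on columns
    and rows. *)
Lemma C_ltP x y : (x < y)%N =
  (col (C x) < col (C y))%N || ((col (C x) == col (C y)) && (row (C x) < row (C y))%N).
Proof.
have lex (z t : 'I_n) : (z < t)%N -> (col (C z) < col (C t))%N ||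
    ((col (C z) == col (C t)) && (row (C z) < row (C t))%N).
  move=> zt; have : col_le (C z) (C t).
    rewrite !ffunE; set s := sort_tuple _ _.
    have b0 := tnth s z; rewrite !(tnth_nth b0).
    apply: sorted_leq_nth => //; rewrite ?inE ?size_tuple ?ltn_ord ?(ltnW zt) //.
    - by move=> b1 b2 b3; rewrite /col_le; lia.
    - by move=> b1; rewrite /col_le; lia.
    - by apply: sort_sorted => b1 b2; rewrite /col_le; lia.
  have Nzt : ~ (row (C z) = row (C t) /\ col (C z) = col (C t)).
    by case=> rE cE; have /C_inj zE := box_eq rE cE; rewrite zE ltnn in zt.
  by rewrite /col_le; lia.
apply/idP/idP => [/lex //|xy]; rewrite ltnNge; apply/negP.
by rewrite leq_eqVlt => /orP[/eqP/val_inj yx|/lex]; move: xy; rewrite ?yx; lia.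
Qed.

Lemma precedes_lt x y : precedes (C x) (C y) -> (x < y)%N.
Proof. by rewrite C_ltP /precedes; lia. Qed.

Lemma act_tab_app g (f : {ffun 'I_n -> box}) x : act_tab g f x = f (g^-1%g x).
Proof. exact: ffunE. Qed.

Lemma act_tabE g (f : {ffun 'I_n -> box}) x : act_tab g f (g x) = f x.
Proof. by rewrite act_tab_app permK. Qed.

Lemma act_tabM g u f : act_tab (g * u)%g f = act_tab u (act_tab g f : {ffun 'I_n -> box}).
Proof. by apply/ffunP => x; rewrite !ffunE invMg permM. Qed.

Lemma act_tab1 (f : {ffun 'I_n -> box}) : act_tab 1%g f = f.
Proof. by apply/ffunP => x; rewrite !ffunE invg1 perm1. Qed.

Lemma act_tab_inj g u : act_tab g C = act_tab u C -> g = u.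
Proof.
move=> /ffunP gu; apply/permP => x; have := gu (g x).
by rewrite act_tabE act_tab_app => /C_inj {2}->; rewrite permKV.
Qed.

Lemma standard_act g : standard (act_tab g C) <->
  forall x y, precedes (C x) (C y) -> (g x < g y)%N.
Proof.
split=> [/and3P[_ _ /forallP st] x y xy|inc].
  have /forallP /(_ (g y)) /implyP := st (g x).
  by rewrite !act_tabE; apply.
apply/and3P; split.
- by apply/injectiveP => x y; rewrite !act_tab_app => /C_inj /perm_inj.
- apply/forallP => b; have [x <-] := C_surj b.
  by rewrite -(act_tabE g C) codom_f.
apply/forallP => x; apply/forallP => y; apply/implyP; rewrite !act_tab_app => xy.
by have := inc _ _ xy; rewrite !permKV.
Qed.

Section Convexity.
Hypotheses (lam_part : is_partition lam) (mu_part : is_partition mu).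

Lemma nth_partition (nu : seq nat) r r' : is_partition nu -> (r <= r')%N ->
  (nth 0 nu r' <= nth 0 nu r)%N.
Proof.
move=> /andP[snu _] rr'; have [r'l|lr'] := ltnP r' (size nu); last by rewrite nth_default.
have geqT : transitive geq by move=> i j k; rewrite /= => ij jk; apply: leq_trans jk ij.
by apply: (sorted_leq_nth geqT leqnn 0%N snu) => //; rewrite inE // (leq_ltn_trans rr').
Qed.

Lemma exists_box_col b b' r : col b = col b' -> (row b <= r <= row b')%N ->
  exists b'', row b'' = r /\ col b'' = col b.
Proof.
move=> cE /andP[br rb']; apply: exists_box => //.
  by apply: leq_trans (box_bounds b).1; apply: nth_partition.
by rewrite cE; apply: leq_trans (box_bounds b').2 _; apply: nth_partition.
Qed.

Lemma exists_box_row b b' s : row b = row b' -> (col b <= s <= col b')%N ->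
  exists b'', row b'' = row b /\ col b'' = s.
Proof.
move=> rE /andP[bs sb']; apply: exists_box => //.
  exact: leq_trans (box_bounds b).1 bs.
by rewrite rE; apply: leq_ltn_trans sb' (box_bounds b').2.
Qed.

(** Columns have no gaps: the box just below that of [lo l] exists, and its entry, being larger than
    [lo l], cannot be smaller than [hi l]. *)
Lemma C_col_next (l : 'I_n.-1) : col (C (lo l)) = col (C (hi l)) ->
  row (C (hi l)) = (row (C (lo l))).+1.
Proof.
move=> cE; have := C_ltP (lo l) (hi l); rewrite /= ltnS leqnn cE ltnn eqxx /= => /esym rlt.
have [//|b [rb cb]] := @exists_box_col _ _ (row (C (lo l))).+1 cE; first by rewrite leqnSn.
have [x xb] := C_surj b; rewrite -xb in rb cb.
have lx : (lo l < x)%N by rewrite C_ltP rb cb eqxx ltnSn orbT.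
have xh : ~~ (x < hi l)%N by rewrite -leqNgt; apply: lx.
move: xh; rewrite C_ltP rb cb cE ltnn eqxx /=; lia.
Qed.

End Convexity.

Lemma increasing_col u :
  (forall l : 'I_n.-1, col (C (lo l)) = col (C (hi l)) -> (u (lo l) < u (hi l))%N) ->
  forall x y, col (C x) = col (C y) -> (x < y)%N -> (u x < u y)%N.
Proof.
move=> uc x y cE xy; apply: increasing_adjacent => // l xl ly; apply: uc.
have : ~~ (lo l < x)%N by rewrite -leqNgt.
have : ~~ (y < hi l)%N by rewrite -leqNgt.
have : (lo l < hi l)%N by rewrite /= ltnSn.
by rewrite !C_ltP; lia.
Qed.

(** Rows have no gaps, so a filling that increases down columns and between horizontal neighbours is
    standard; a failure therefore occurs between neighbours. *)
Lemma nonstandard_descent u : is_partition lam ->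
  (forall l : 'I_n.-1, col (C (lo l)) = col (C (hi l)) -> (u (lo l) < u (hi l))%N) ->
  ~~ standard (act_tab u C) ->
  exists x y, [/\ row (C y) = row (C x), col (C y) = (col (C x)).+1 & (u y < u x)%N].
Proof.
move=> lam_part uc; apply: contraPP => Nxy; apply/negP/negPn/standard_act => x y.
have ucol := increasing_col uc.
move=> xy; have xlty := precedes_lt xy.
have [cE|cN] := eqVneq (col (C x)) (col (C y)); first exact: ucol.
have {xy} [rE clt] : row (C x) = row (C y) /\ (col (C x) < col (C y))%N.
  by move: xy; rewrite /precedes; lia.
(* Induction on the number of columns strictly between the two boxes. *)
move: {2}(col (C y) - col (C x)).-1%N (erefl (col (C y) - col (C x)).-1%N) => k.
elim: k x rE clt {xlty cN} => [|k IH] x rE clt kE.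
  rewrite ltnNge leq_eqVlt; apply/norP; split.
    apply/eqP => /val_inj /perm_inj yx; by rewrite yx ltnn in clt.
  by apply/negP => yx; apply: Nxy; exists x, y; split => //; lia.
have [|b [rb cb]] := @exists_box_row lam_part _ _ (col (C x)).+1 rE; first by lia.
have [z zb] := C_surj b; rewrite -zb in rb cb.
apply: (@ltn_trans (u z)); last by apply: IH; lia.
rewrite ltnNge leq_eqVlt; apply/norP; split.
  apply/eqP => /val_inj /perm_inj zx; rewrite zx in cb; lia.
by apply/negP => zx; apply: Nxy; exists x, z.
Qed.

End ColumnReading.

(** * Permutations of a segment of entries that increase on its two columns *)

Section GarnirSet.
Import Defs.
Variables lam mu : seq nat.
Local Notation n := (nboxes lam mu).
Local Notation C := (col_reading lam mu).
Implicit Types (x y : 'I_n) (g u d : 'S_n).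

(** Exchanging l and l + 1 could only break standardness if the box of l preceded that of l + 1, but
    then [C] would number these boxes in the same order, against the descent. *)
Lemma standard_descent (l : 'I_n.-1) g : standard (act_tab g C) ->
  (g^-1%g (hi l) < g^-1%g (lo l))%N -> standard (act_tab (g * strans l)%g C).
Proof.
move=> /standard_act ginc gl; apply/standard_act => x y xy; rewrite !permM.
apply: (strans_mono (ginc _ _ xy)) => -[gx gy]; move: gl.
have -> : lo l = g x by exact: val_inj.
have -> : hi l = g y by exact: val_inj.
by rewrite !permK ltnNge (ltnW (precedes_lt xy)).
Qed.

Variables a b : 'I_n.
Local Notation S := (seg a b).

(* The shortest representatives of the cosets in S_[a, b] of the permutations
   that preserve the columns. *)
Definition garnir_set : {set 'S_n} := [set d | perm_on S d &&
  [forall x in S, forall y in S,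
    (x < y)%N && (col (C x) == col (C y)) ==> (d x < d y)%N]].
Local Notation D := garnir_set.

Lemma garnir_setP d : reflect (perm_on S d /\
    forall x y, x \in S -> y \in S -> (x < y)%N -> col (C x) = col (C y) ->
      (d x < d y)%N)
  (d \in D).
Proof.
rewrite inE; apply: (iffP andP) => -[dS].
  move=> /forall_inP dc; split=> // x y xS yS xy cE.
  by have /forall_inP /(_ y yS) /implyP := dc x xS; apply; rewrite xy cE eqxx.
move=> dc; split=> //; apply/forall_inP => x xS; apply/forall_inP => y yS.
by apply/implyP => /andP[xy /eqP cE]; apply: dc.
Qed.

(** An entry of [C] strictly between the two preimages would lie in the same column, and [d] would
    send it strictly between l and l + 1. *)
Lemma garnir_consecutive (l : 'I_n.-1) d : d \in D ->
  col (C (d^-1%g (lo l))) = col (C (d^-1%g (hi l))) -> lo l \in S -> hi l \in S ->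
  exists k : 'I_n.-1, lo k = d^-1%g (lo l) /\ hi k = d^-1%g (hi l).
Proof.
move=> /garnir_setP[dS dc] cE ll lh.
set x := d^-1%g (lo l) in cE *; set y := d^-1%g (hi l) in cE *.
have dVS := perm_on_segV dS.
have xS : x \in S by rewrite perm_closed.
have yS : y \in S by rewrite perm_closed.
have dx : d x = l :> nat by rewrite permKV.
have dy : d y = l.+1 :> nat by rewrite permKV.
have xy : (x < y)%N.
  have [//|yx|xy] := ltngtP x y.
    by have := dc _ _ yS xS yx (esym cE); lia.
  by have := dy; rewrite -(val_inj xy); lia.
have yE : y = x.+1 :> nat.
  apply/eqP; rewrite eqn_leq xy andbT leqNgt; apply/negP => x1y.
  have x1n : (x.+1 < n)%N by apply: ltn_trans x1y _.
  have [w wE] : exists w : 'I_n, w = x.+1 :> nat by exists (Ordinal x1n).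
  have wS : w \in S by move: xS yS; rewrite !in_seg; lia.
  have xw : (x < w)%N by rewrite wE.
  have wy : (w < y)%N by rewrite wE.
  have cw : col (C x) = col (C w) by move: (xw) (wy); rewrite !C_ltP; lia.
  have := dc _ _ xS wS xw cw; have := dc _ _ wS yS wy (etrans (esym cw) cE).
  by lia.
have xn : (x < n.-1)%N by have := ltn_ord y; lia.
by exists (Ordinal xn); split; apply: val_inj => //=.
Qed.

Lemma garnir_swap (l : 'I_n.-1) d : lo l \in S -> hi l \in S -> d \in D ->
  col (C (d^-1%g (lo l))) <> col (C (d^-1%g (hi l))) -> (d * strans l)%g \in D.
Proof.
move=> ll lh /garnir_setP[dS dc] cN; apply/garnir_setP; split.
  by rewrite perm_onM ?perm_on_strans.
move=> x y xS yS xy cE; rewrite !permM; have dxy := dc _ _ xS yS xy cE.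
have Nlh : ~ (d x = l :> nat /\ d y = l.+1 :> nat).
  case=> dx dy; apply: cN; have -> : lo l = d x by exact: val_inj.
  by have -> : hi l = d y; [exact: val_inj | rewrite !permK].
exact: strans_mono.
Qed.

Hypotheses (ab_row : row (C b) = row (C a)) (ab_col : col (C b) = (col (C a)).+1).

(** The reading from [a] to [b] goes down the column of [a] from [a] on, then down the next column
    as far as [b]. *)
Lemma seg_col x : x \in S -> col (C x) = col (C a) /\ (row (C a) <= row (C x))%N \/
  col (C x) = col (C b) /\ (row (C x) <= row (C a))%N.
Proof.
rewrite in_seg => /andP[ax xb].
have : ~~ (x < a)%N by rewrite -leqNgt.
have : ~~ (b < x)%N by rewrite -leqNgt.
by rewrite !C_ltP ab_row ab_col; lia.
Qed.

Lemma garnir_ab_lt : (a < b)%N.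
Proof. by rewrite C_ltP ab_col ltnSn. Qed.

Lemma seg_left : a \in S.
Proof. by rewrite in_seg leqnn ltnW // garnir_ab_lt. Qed.

Lemma seg_right : b \in S.
Proof. by rewrite in_seg leqnn ltnW // garnir_ab_lt. Qed.

(** The last number is the content difference of the two boxes, see [seg_content]. It is 1 only if
    both lie in the row of [a], where standardness excludes the descent. *)
Lemma descent_boxes (l : 'I_n.-1) g : standard (act_tab g C) ->
  let x := g^-1%g (lo l) in let y := g^-1%g (hi l) in
  (y < x)%N -> x \in S -> y \in S ->
  [/\ col (C y) = col (C a), col (C x) = col (C b) &
     (2 <= 1 + (row (C y) - row (C a)) + (row (C a) - row (C x)))%N].
Proof.
move=> /standard_act ginc x y yltx xS yS.
have yx : ~~ precedes (C y) (C x).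
  by apply/negP => /ginc; rewrite !permKV /= ltnNge leqnSn.
move: yltx yx; rewrite C_ltP /precedes.
by case: (seg_col xS) (seg_col yS) => -[? ?] [[? ?]|[? ?]]; split; lia.
Qed.

Variable d : 'S_n.
Hypotheses (dD : d \in D) (dab : (d b < d a)%N).

(** On the left column [d] is smallest at [a], on the right column it is largest at [b]; so
    inverting this one pair forces the inversion of all pairs across the columns. *)
Lemma garnir_inversion x y : x \in S -> y \in S ->
  col (C x) = col (C a) -> col (C y) = col (C b) -> (d y < d x)%N.
Proof.
case/garnir_setP: dD => dS dc xS yS cx cy.
have aS := seg_left; have bS := seg_right.
have ax : (d a <= d x)%N.
  have [->//|ax] := eqVneq a x; apply/ltnW/dc => //.
  by move: xS ax; rewrite in_seg -val_eqE /=; lia.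
have yb : (d y <= d b)%N.
  have [->//|yb] := eqVneq y b; apply/ltnW/dc => //.
  by move: yS yb; rewrite in_seg -val_eqE /=; lia.
by lia.
Qed.

(** A value strictly between [d b] and [d a] would come from the left column, whose values are at
    least [d a], or from the right one, whose values are at most [d b]. *)
Lemma garnir_max_succ : d a = (d b).+1 :> nat.
Proof.
case/garnir_setP: (dD) => dS dc; have aS := seg_left; have bS := seg_right.
apply/eqP; rewrite eqn_leq dab andbT leqNgt; apply/negP => ba.
have wn : ((d b).+1 < n)%N by apply: ltn_trans ba _.
pose w : 'I_n := Ordinal wn; pose z := d^-1%g w.
have dz : d z = (d b).+1 :> nat by rewrite permKV.
have zS : z \in S.
  rewrite -(perm_closed z dS) in_seg dz.
  have : d a \in S by rewrite perm_closed.
  have : d b \in S by rewrite perm_closed.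
  by rewrite !in_seg; lia.
case: (seg_col zS) => -[cz _].
  have [za|za] := eqVneq z a; first by move: ba; rewrite -za dz /=; lia.
  have az : (a < z)%N by move: zS za; rewrite in_seg -val_eqE /=; lia.
  by have := dc _ _ aS zS az (esym cz); rewrite dz /=; lia.
have [zb|zb] := eqVneq z b; first by move: dz; rewrite zb; lia.
have zltb : (z < b)%N by move: zS zb; rewrite in_seg -val_eqE /=; lia.
by have := dc _ _ zS bS zltb cz; rewrite dz /=; lia.
Qed.

Lemma garnir_max_consecutive : exists l : 'I_n.-1, d b = lo l /\ d a = hi l.
Proof.
have dE := garnir_max_succ.
have ln : (d b < n.-1)%N by have := ltn_ord (d a); lia.
by exists (Ordinal ln); split; apply: val_inj.
Qed.

(** The only boxes of the segment in different columns and in a common row are those of [a] and [b],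
    and the exchange puts exactly these in order without affecting the order within columns. *)
Lemma garnir_max_standard (l : 'I_n.-1) : d b = lo l -> d a = hi l ->
  standard (act_tab (d * strans l)%g C).
Proof.
case/garnir_setP: (dD) => dS dc db da.
have lS : perm_on S (strans l).
  by apply: perm_on_strans; rewrite -?db -?da perm_closed ?seg_left ?seg_right.
have sS : perm_on S (d * strans l)%g by rewrite perm_onM.
apply/standard_act => x y xy; have xlty := precedes_lt xy.
have [/andP[xS yS]|] := boolP ((x \in S) && (y \in S)); last first.
  by move/(perm_on_seg_mono sS); apply.
rewrite !permM; have [cE|cN] := eqVneq (col (C x)) (col (C y)).
  apply: strans_mono; first exact: dc.
  case=> dx _; have xb : x = b.
    by apply: (@perm_inj _ d); apply: ord_inj; rewrite dx db.
  by move: yS xlty; rewrite xb in_seg; lia.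
have [xa yb] : x = a /\ y = b.
  have [rx [ry [cx cy]]] : row (C x) = row (C a) /\ row (C y) = row (C b) /\
      col (C x) = col (C a) /\ col (C y) = col (C b).
    move: xy; rewrite /precedes.
    by case: (seg_col xS) (seg_col yS) => -[? ?] [[? ?]|[? ?]]; lia.
  by split; apply: (@C_inj lam mu); apply: box_eq.
by rewrite xa yb da db strans_hi strans_lo /=.
Qed.

(** All inversions of [g] are across the two columns, hence are inversions of [d]; equal lengths
    would make the inversion sets, and so the permutations, equal. *)
Lemma garnir_max g : g \in D -> g != d -> (len g < len d)%N.
Proof.
case/garnir_setP: (dD) => dS dc /garnir_setP[gS gc] gd.
have sub : inv_set g \subset inv_set d.
  apply/fintype.subsetP => -[x y]; rewrite !in_inv_set => /andP[xy yx]; rewrite xy /=.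
  have [xS yS] : x \in S /\ y \in S.
    by apply/andP/negPn/negP => /(perm_on_seg_mono gS) /(_ xy); lia.
  have cN : col (C x) <> col (C y) by move=> /(gc _ _ xS yS xy); lia.
  have [cx cy] : col (C x) = col (C a) /\ col (C y) = col (C b).
    by move: xy; rewrite C_ltP; case: (seg_col xS) (seg_col yS) => -[? ?] [[? ?]|[? ?]]; lia.
  exact: garnir_inversion.
rewrite ltn_neqAle subset_leq_card // andbT; apply: contra gd => /eqP lE.
by apply/eqP/inv_set_inj/eqP; rewrite eqEcard sub -/(len d) -/(len g) lE leqnn.
Qed.

End GarnirSet.

(** * Closure properties of the ring of Laurent polynomials in q *)

Section LaurentRing.
Variables (R : realType) (q : R[i]).
Hypothesis q_neq0 : q != 0.
Implicit Types y z : R[i].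

Lemma in_Zqq_int (m : int) : in_Zqq q m%:~R.
Proof. by exists m%:P, 0%N; rewrite map_polyC hornerC expr0 divr1. Qed.

Lemma in_Zqq0 : in_Zqq q 0. Proof. exact: (in_Zqq_int 0). Qed.
Lemma in_Zqq1 : in_Zqq q 1. Proof. exact: (in_Zqq_int 1). Qed.

Lemma in_Zqq_q : in_Zqq q q.
Proof. by exists 'X, 0%N; rewrite map_polyX hornerX expr0 divr1. Qed.

Lemma in_Zqq_qV : in_Zqq q q^-1.
Proof. by exists 1, 1%N; rewrite rmorph1 hornerC expr1 div1r. Qed.

Lemma in_ZqqD y z : in_Zqq q y -> in_Zqq q z -> in_Zqq q (y + z).
Proof.
move=> [p [k ->]] [p' [k' ->]]; exists (p * 'X^k' + p' * 'X^k), (k + k')%N.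
rewrite rmorphD !rmorphM /= !map_polyXn !hornerE exprD.
by field; rewrite !expf_neq0.
Qed.

Lemma in_ZqqM y z : in_Zqq q y -> in_Zqq q z -> in_Zqq q (y * z).
Proof.
move=> [p [k ->]] [p' [k' ->]]; exists (p * p'), (k + k')%N.
by rewrite rmorphM /= hornerM exprD invfM mulrACA.
Qed.

Lemma in_ZqqN y : in_Zqq q y -> in_Zqq q (- y).
Proof. by rewrite -mulN1r; apply: in_ZqqM; apply: (in_Zqq_int (-1)). Qed.

Lemma in_ZqqB y z : in_Zqq q y -> in_Zqq q z -> in_Zqq q (y - z).
Proof. by move=> yZ /in_ZqqN; apply: in_ZqqD. Qed.

Lemma in_Zqq_expn y k : in_Zqq q y -> in_Zqq q (y ^+ k).
Proof.
move=> yZ; elim: k => [|k IH]; first exact: in_Zqq1.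
by rewrite exprS; apply: in_ZqqM.
Qed.

Lemma in_Zqq_expz (m : int) : in_Zqq q (q ^ m).
Proof.
case: m => k; first exact/in_Zqq_expn/in_Zqq_q.
by rewrite NegzE -exprnN -exprVn; apply/in_Zqq_expn/in_Zqq_qV.
Qed.

End LaurentRing.

(** * Matrix coefficients of T_i as functions of the content difference *)

Section ContentPowers.
Variables (R : realType) (q ell : R[i]).
Hypotheses (q_neq0 : q != 0) (q_nroot : forall k : nat, (0 < k)%N -> q ^+ k != 1).
Hypothesis ell_log : cexp ell = q ^+ 2.

Lemma cexpD (y z : R[i]) : cexp (y + z) = cexp y * cexp z.
Proof.
case: y z => [a b] [a' b']; rewrite /cexp /= expRD cosD sinD; simpc.
by congr (_ +i* _); ring.
Qed.

Lemma cexp0 : cexp (0 : R[i]) = 1.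
Proof. by rewrite /cexp /= expR0 cos0 sin0; simpc. Qed.

Lemma q2pow_int (m : int) : q2pow ell m%:~R = q ^ (2 * m).
Proof.
have nat_case k : q2pow ell k%:R = q ^+ (2 * k).
  elim: k => [|k IH]; first by rewrite /q2pow mulr0 cexp0 muln0.
  rewrite /q2pow -natr1 mulrDr mulr1 cexpD -/(q2pow ell _) IH ell_log.
  by rewrite mulnS addnC exprD.
case: m => k; first by rewrite -exprnP -nat_case.
apply: (@mulIf _ (q2pow ell k.+1%:R)); first by rewrite nat_case expf_neq0.
rewrite {1}/q2pow NegzE mulrNz mulrN -cexpD addNr cexp0 nat_case.
by rewrite mulrN -PoszM -exprnN mulVf // expf_neq0.
Qed.

Lemma expz_neq1 (m : int) : m != 0 -> q ^ m != 1.
Proof.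
case: m => k k0; first by apply: q_nroot; lia.
by rewrite NegzE -exprnN invr_eq1 q_nroot.
Qed.

Definition tdiag (z : R[i]) : R[i] := (q - q^-1) / (1 - q2pow ell z).

Lemma sqr_q_neq1 : 1 - q ^+ 2 != 0.
Proof. by rewrite subr_eq0 eq_sym q_nroot. Qed.

Lemma q_add_qV : q^-1 + q != 0.
Proof.
apply/eqP => q0; have : q ^+ 4 != 1 by rewrite q_nroot.
(* This is the factorization of q^4 - 1 as (q^2 - 1)(q^2 + 1). *)
have -> : q ^+ 4 = 1 + q * (q ^+ 2 - 1) * (q^-1 + q) by field.
by rewrite q0 mulr0 addr0 eqxx.
Qed.

(** The argument -1 is the content difference for i and i + 1 side by side in a row; in [tdiag_col]
    the argument 1 is that for i + 1 just below i. *)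
Lemma tdiag_row : tdiag (-1) = q.
Proof.
rewrite /tdiag (q2pow_int (-1)) -[q ^ _]/(q ^- 2).
field; rewrite q_neq0 /=; have := sqr_q_neq1; rewrite -oppr_eq0 opprB.
by rewrite expr2.
Qed.

Lemma tdiag_col : tdiag 1 = - q^-1.
Proof.
rewrite /tdiag (q2pow_int 1) -[q ^ _]/(q ^+ 2).
by field; rewrite q_neq0 sqr_q_neq1.
Qed.

(** The off-diagonal coefficient is q (1 - q^(2(m-1))) / (1 - q^(2m)), whose numerator vanishes only
    at m = 1, as q is not a root of unity. *)
Lemma tdiag_neq (m : int) : m != 1 -> q^-1 + tdiag m%:~R != 0.
Proof.
move=> m1; rewrite /tdiag q2pow_int.
(* Division by zero yields 0, so only q^-1 remains in this case. *)
have [->|Q1] := eqVneq (q ^ (2 * m)) 1; first by rewrite subrr invr0 mulr0 addr0 invr_neq0.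
have Qm : 1 - q ^ (2 * m) != 0 by rewrite subr_eq0 eq_sym.
have -> : q^-1 + (q - q^-1) / (1 - q ^ (2 * m))
    = q * (1 - q ^ (2 * (m - 1))) / (1 - q ^ (2 * m)).
  have qm : q ^ (2 * m) = q ^ (2 * (m - 1)) * q ^+ 2.
    by rewrite -[q ^+ 2]/(q ^ 2) -expfzDr //; congr (_ ^ _); ring.
  by rewrite qm in Qm *; field; rewrite q_neq0 Qm.
rewrite !mulf_neq0 ?invr_neq0 // subr_eq0 eq_sym expz_neq1 //.
by rewrite mulf_neq0 // subr_eq0.
Qed.

Lemma tdiag_nat_neq (m : nat) : (2 <= m)%N ->
  q^-1 + tdiag m%:R != 0 /\ q^-1 + tdiag (- m%:R) != 0.
Proof.
move=> m2; split; first by apply: (@tdiag_neq m%:Z); lia.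
by rewrite -(mulrNz 1 m%:Z); apply: tdiag_neq; lia.
Qed.

End ContentPowers.

(** * Contents along rows and columns of a placed skew shape *)

Section Contents.
Import Defs.
Variables (R : realType) (ell : R[i]) (lam mu : seq nat).
Variable c : skew_box lam mu -> R[i].
Hypothesis c_placed : placed ell c.
Implicit Types b : skew_box lam mu.

Lemma box_surj b : exists i, box_ i = b.
Proof.
have : b \in sort_tuple (@diag_le lam mu) (enum_tuple {: skew_box lam mu}).
  by rewrite mem_sort mem_enum.
by case/tnthP => i ->; exists i.
Qed.

Lemma content_succ b b' : diag b' = diag b + 1 -> c b' = c b + 1.
Proof.
have [i <-] := box_surj b; have [j <-] := box_surj b'.
by case: c_placed => _ _ succP _; case: (succP i j).
Qed.

Lemma content_row b b' : row b' = row b -> col b' = (col b).+1 -> c b' = c b + 1.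
Proof. by move=> rE cE; apply: content_succ; rewrite /diag rE cE; lia. Qed.

Lemma content_col_next b b' : col b' = col b -> row b' = (row b).+1 -> c b = c b' + 1.
Proof. by move=> cE rE; apply: content_succ; rewrite /diag rE cE; lia. Qed.

Lemma content_col b b' : is_partition lam -> is_partition mu ->
  col b = col b' -> (row b <= row b')%N -> c b = c b' + (row b' - row b)%N%:R.
Proof.
move=> lam_part mu_part cE.
move: {2}(row b' - row b)%N (erefl (row b' - row b)%N) => k.
elim: k b cE => [|k IH] b cE kE br.
  by rewrite kE addr0 (@box_eq _ _ b b') //; lia.
have [|b1 [r1 c1]] := @exists_box_col _ _ lam_part mu_part _ _ (row b).+1 cE; first by lia.
rewrite (content_col_next c1 r1) (IH b1); [|lia..].
by rewrite kE (_ : (row b' - row b1)%N = k) -?addrA ?natr1 //; lia.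
Qed.

End Contents.

(** * The skew module: coordinates and the action on v_C *)

Section SkewModule.
Import Defs.
Variables (R : realType) (q ell : R[i]).
Hypotheses (q_neq0 : q != 0) (q_nroot : forall k : nat, (0 < k)%N -> q ^+ k != 1).
Hypothesis ell_log : cexp ell = q ^+ 2.
Variables lam mu : seq nat.
Hypotheses (lam_part : is_partition lam) (mu_part : is_partition mu).
Variable c : skew_box lam mu -> R[i].
Hypothesis c_placed : placed ell c.
Local Notation n := (nboxes lam mu).
Local Notation C := (col_reading lam mu).
Local Notation filling := {ffun 'I_n -> skew_box lam mu}.
Variables (A : unitAlgType R[i]) (T : 'I_n.-1 -> A) (M : lmodType A).
Hypothesis T_comm : forall i j : 'I_n.-1, (i.+1 < j)%N -> T i * T j = T j * T i.
Hypothesis T_braid : forall i j : 'I_n.-1, j = i.+1 :> nat ->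
  T i * T j * T i = T j * T i * T j.
Hypothesis T_quad : forall i, T i * T i = (q - q^-1) *: T i + 1.
Variable v : std_tab lam mu -> M.
Hypothesis v_basis : forall m : M, exists! a : {ffun std_tab lam mu -> R[i]},
  m = \sum_(L : std_tab lam mu) (a L)%:A *: v L.
Hypothesis T_v : forall (i : 'I_n.-1) (L : std_tab lam mu),
  T i *: v L = (Tdiag q ell c i L)%:A *: v L
    + (q^-1 + Tdiag q ell c i L)%:A *: vext v (act_tab (strans i) (val L)).
Implicit Types (f : filling) (g u d : 'S_n) (x y : 'I_n) (m : M) (z t : R[i]).

(** Complex numbers act on [M] through [A], so this and the next rules stand in for those of a
    complex vector space. *)
Lemma scalar_mul z t m : z%:A *: (t%:A *: m) = (z * t)%:A *: m.
Proof. by rewrite scalerA -scalerAl mul1r scalerA. Qed.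

Lemma scalar_alg z (h : A) m : (z *: h) *: m = z%:A *: (h *: m).
Proof. by rewrite scalerA -scalerAl mul1r. Qed.

Lemma scalar_comm z (h : A) m : h *: (z%:A *: m) = z%:A *: (h *: m).
Proof. by rewrite -scalar_alg scalerA -scalerAr mulr1. Qed.

Lemma scalarD z t m : (z + t)%:A *: m = z%:A *: m + t%:A *: m.
Proof. by rewrite !scalerDl. Qed.

Lemma scalar0 m : (0 : R[i])%:A *: m = 0.
Proof. by rewrite !scale0r. Qed.

Lemma scalar1 m : (1 : R[i])%:A *: m = m.
Proof. by rewrite !scale1r. Qed.

Lemma scalarN z m : (- z)%:A *: m = - (z%:A *: m).
Proof. by rewrite !scaleNr. Qed.

Definition diag_coef (i : 'I_n.-1) f : R[i] :=
  tdiag q ell (c (f (lo i)) - c (f (hi i))).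

Lemma vext_nonstandard f : ~~ standard f -> vext v f = 0.
Proof. by move=> fN; rewrite /vext insubN. Qed.

Lemma T_vext i f : standard f -> T i *: vext v f =
  (diag_coef i f)%:A *: vext v f
    + (q^-1 + diag_coef i f)%:A *: vext v (act_tab (strans i) f).
Proof.
move=> fs; have -> : vext v f = v (Sub f fs) by rewrite /vext insubT.
by rewrite T_v /Tdiag /diag_coef SubK.
Qed.

Lemma act_strans_invol i : involutive (act_tab (strans i) : filling -> filling).
Proof. by move=> f; rewrite -act_tabM stransK act_tab1. Qed.

(** Summing over all fillings makes the exchange of two entries a bijection of the index set.
    Coefficients have to vanish off the standard fillings, since such a filling may become standard
    by the exchange. *)
Lemma T_sum_vext i (bt : filling -> R[i]) : (forall f, ~~ standard f -> bt f = 0) ->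
  T i *: \sum_f (bt f)%:A *: vext v f =
  \sum_f (bt f * diag_coef i f
    + bt (act_tab (strans i) f) * (q^-1 + diag_coef i (act_tab (strans i) f)))%:A
      *: vext v f.
Proof.
move=> btN; under [RHS]eq_bigr do rewrite scalarD.
rewrite big_split /= [X in _ = _ + X](reindex_inj (inv_inj (act_strans_invol i))) /=.
rewrite -big_split scaler_sumr /=; apply: eq_bigr => f _; rewrite act_strans_invol.
have [fs|/btN ->] := boolP (standard f).
  by rewrite scalar_comm T_vext // scalerDr !scalar_mul.
by rewrite !mul0r !scalar0 scaler0 addr0.
Qed.

(** The zero family and the restriction of [bt] to standard tableaux both represent 0, and
    coordinates are unique. *)
Lemma vext_free (bt : filling -> R[i]) :
  \sum_f (bt f)%:A *: vext v f = 0 -> forall f, standard f -> bt f = 0.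
Proof.
move=> bt0 f fs; have [a [_ uniq_a]] := v_basis 0.
have sumE : \sum_f (bt f)%:A *: vext v f = \sum_L (bt (val L))%:A *: v L.
  rewrite (bigID (fun f => standard f)) /= [X in _ + X]big1; last first.
    by move=> f' /vext_nonstandard ->; rewrite scaler0.
  rewrite addr0 (reindex_omap (val : std_tab lam mu -> filling) insub) /=; last first.
    by move=> f' f's; rewrite insubT.
  apply: eq_big => [L|L _]; last by rewrite /vext valK.
  by rewrite valK eqxx andbT (valP L).
have a0 : a = [ffun=> 0].
  apply: uniq_a; rewrite big1 // => L _; by rewrite ffunE scalar0.
have ab : a = [ffun L => bt (val L)].
  by apply: uniq_a; rewrite -[LHS]bt0 sumE; apply: eq_bigr => L _; rewrite ffunE.
have := congr1 (fun h : {ffun _} => h (Sub f fs)) (etrans (esym ab) a0).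
by rewrite !ffunE SubK.
Qed.

Definition Tvec u : M := Tw T u *: v (C_tab lam mu).

Lemma Tvec1 : Tvec 1%g = vext v C.
Proof.
rewrite /Tvec (Tw1 T_comm T_braid) scale1r /vext.
by rewrite (insubT _ (col_reading_standard lam mu)).
Qed.

Lemma T_col (l : 'I_n.-1) : col (C (lo l)) = col (C (hi l)) ->
  T l *: v (C_tab lam mu) = (- q^-1)%:A *: v (C_tab lam mu).
Proof.
move=> cE; rewrite T_v; suff -> : Tdiag q ell c l (C_tab lam mu) = - q^-1.
  by rewrite subrr scalar0 addr0.
have := C_col_next lam_part mu_part cE => /(content_col_next c_placed (esym cE)) cc.
by rewrite /Tdiag SubK -/(tdiag q ell _) cc addrAC subrr add0r (tdiag_col q_neq0 q_nroot ell_log).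
Qed.

Lemma Tvec_col_descent (l : 'I_n.-1) u : col (C (lo l)) = col (C (hi l)) ->
  (u (hi l) < u (lo l))%N -> Tvec u = (- q^-1)%:A *: Tvec (strans l * u)%g.
Proof.
move=> cE hl; rewrite /Tvec -scalar_comm -(T_col cE) scalerA (Tw_mul_T T_comm T_braid).
  by rewrite mulgA stransK mul1g.
by rewrite !permM strans_lo strans_hi.
Qed.

(** * The Garnir relation on the segment from a to b *)

Section Garnir.
Variables a b : 'I_n.
Hypotheses (ab_row : row (C b) = row (C a)) (ab_col : col (C b) = (col (C a)).+1).
Local Notation S := (seg a b).

Local Notation D := (garnir_set a b).

Definition garnir : A := \sum_(d in D) (- q) ^- len d *: Tw T d.

(** The preimages of l and l + 1 are consecutive entries k and k + 1 of one column of [C], so T_l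
    T_d = T_d T_k, and T_k acts on v_C by - q^-1. *)
Lemma garnir_same_col (l : 'I_n.-1) d : d \in D ->
  col (C (d^-1%g (lo l))) = col (C (d^-1%g (hi l))) -> lo l \in S -> hi l \in S ->
  T l *: Tvec d = (- q^-1)%:A *: Tvec d.
Proof.
move=> dD cE ll lh; have [k [kx ky]] := garnir_consecutive dD cE ll lh.
rewrite /Tvec scalerA (T_mul_Tw T_comm T_braid) -?kx -?ky //.
have -> : (d * strans l = strans k * d)%g.
  by rewrite [RHS]conjgC /strans tpermJ kx ky !permKV.
rewrite -(Tw_mul_T T_comm T_braid) ?kx ?ky ?permKV //=.
by rewrite -scalerA T_col ?kx ?ky // scalar_comm.
Qed.

(** Up to a scalar the two terms add up to (T_l + q^-1)(1 - q^-1 T_l) T_d, which vanishes by the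
    quadratic relation (T_l - q)(T_l + q^-1) = 0. *)
Lemma garnir_pair (l : 'I_n.-1) d : (d^-1%g (lo l) < d^-1%g (hi l))%N ->
  (- q) ^- len d *: ((T l + q^-1%:A) * Tw T d) +
  (- q) ^- len (d * strans l)%g *: ((T l + q^-1%:A) * Tw T (d * strans l)%g) = 0.
Proof.
move=> up; rewrite (len_mul_strans up) -(T_mul_Tw T_comm T_braid up) !mulrDl.
rewrite mulrA T_quad mulrDl mul1r -!scalerAl !mul1r.
rewrite exprSr invfM -scalerA -scalerDr; set X := T l * _; set Y := Tw T d.
suff -> : X + q^-1 *: Y + (- q)^-1 *: ((q - q^-1) *: X + Y + q^-1 *: X) = 0.
  by rewrite scaler0.
have -> : (q - q^-1) *: X + Y + q^-1 *: X = q *: X + Y.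
  by rewrite addrAC -scalerDl subrK.
rewrite invrN scaleNr scalerDr scalerA mulVf // scale1r.
by rewrite opprD addrACA !subrr addr0.
Qed.

(** The involution [phi] fixes the [d] for which l and l + 1 come from one column, whose terms are
    killed separately, and exchanges [d] with [d * strans l] otherwise, where [garnir_pair]
    applies. *)
Lemma garnir_eigen (l : 'I_n.-1) : lo l \in S -> hi l \in S ->
  (T l + q^-1%:A) *: (garnir *: v (C_tab lam mu)) = 0.
Proof.
move=> ll lh.
pose Z d := ((- q) ^- len d *: ((T l + q^-1%:A) * Tw T d)) *: v (C_tab lam mu).
have -> : (T l + q^-1%:A) *: (garnir *: v (C_tab lam mu)) = \sum_(d in D) Z d.
  rewrite scalerA /garnir mulr_sumr scaler_suml; apply: eq_bigr => d _.
  by rewrite /Z scalerAr.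
pose cE d := col (C (d^-1%g (lo l))) == col (C (d^-1%g (hi l))).
pose phi d := if cE d then d else (d * strans l)%g.
have loV d : ((d * strans l)^-1)%g (lo l) = d^-1%g (hi l).
  by rewrite invMg stransV permM strans_lo.
have hiV d : ((d * strans l)^-1)%g (hi l) = d^-1%g (lo l).
  by rewrite invMg stransV permM strans_hi.
have cEs d : cE (d * strans l)%g = cE d by rewrite /cE loV hiV eq_sym.
have phiK : involutive phi.
  move=> d; rewrite {2}/phi; case cd: (cE d); rewrite /phi ?cd //.
  by rewrite cEs cd strans_mulK.
have phiD d : d \in D -> phi d \in D.
  by move=> dD; rewrite /phi /cE; case: eqP => // cN; apply: garnir_swap.
have pair d : d \in D -> Z d + Z (phi d) = 0.
  move=> dD; rewrite /phi; case: ifP => [/eqP cd|_].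
    suff -> : Z d = 0 by rewrite addr0.
    rewrite /Z scalar_alg -scalerA scalerDl (garnir_same_col dD cd ll lh).
    by rewrite -scalarD addNr scalar0 scaler0.
  have := @perm_val_neq _ d^-1%g (lo l) (hi l) => /=.
  case: (ltngtP (d^-1%g (lo l)) (d^-1%g (hi l))) => [up _|dn _|_ /(_ (@n_Sn _)) //].
    by rewrite /Z -scalerDl garnir_pair ?scale0r.
  (* The same pair, with [d * strans l] as its shorter member. *)
  rewrite -{1}(strans_mulK l d) addrC /Z -scalerDl garnir_pair ?scale0r //.
  by rewrite loV hiV.
(* Reindexing one copy by [phi] makes twice the sum vanish. *)
have : \sum_(d in D) Z d + \sum_(d in D) Z d = 0.
  rewrite [X in _ + X](reindex_inj (inv_inj phiK)) /=.
  rewrite [X in _ + X](eq_bigl (mem D)) => [|d]; last first.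
    by apply/idP/idP => /phiD //; rewrite phiK.
  by rewrite -big_split big1 // => d /pair.
move=> s0; rewrite -[LHS]scalar1 -(@mulVf _ 2) ?pnatr_eq0 // -scalar_mul.
by rewrite (natrD _ 1 1) scalarD scalar1 s0 scaler0.
Qed.

Definition supported m : Prop := exists bt : filling -> R[i],
  (forall f, bt f != 0 -> standard f /\ exists2 g, perm_on S g & f = act_tab g C) /\
  m = \sum_f (bt f)%:A *: vext v f.

Lemma supported_sum (I : finType) (P : pred I) (k : I -> R[i]) (m : I -> M) :
  (forall i, P i -> supported (m i)) -> supported (\sum_(i | P i) (k i)%:A *: m i).
Proof.
move=> mP; elim/big_ind: _ => [|m1 m2 [b1 [b1S ->]] [b2 [b2S ->]]|i /mP [bt [btS ->]]].
- exists (fun=> 0); split=> [f|]; first by rewrite eqxx.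
  by rewrite big1 // => f _; rewrite scalar0.
- exists (fun f => b1 f + b2 f); split=> [f|].
    by have [->|/b1S //] := eqVneq (b1 f) 0; rewrite add0r => /b2S.
  by rewrite -big_split; apply: eq_bigr => f _; rewrite scalarD.
- exists (fun f => k i * bt f); split=> [f|]; first by rewrite mulf_eq0 => /norP[_ /btS].
  by rewrite scaler_sumr; apply: eq_bigr => f _; rewrite scalar_mul.
Qed.

Lemma supported_T (l : 'I_n.-1) m : lo l \in S -> hi l \in S ->
  supported m -> supported (T l *: m).
Proof.
move=> ll lh [bt [btS ->]].
have btN f : ~~ standard f -> bt f = 0.
  by move=> fN; apply/eqP; apply: contraNT fN => /btS[].
rewrite T_sum_vext //; pose bt' f := bt f * diag_coef l f
  + bt (act_tab (strans l) f) * (q^-1 + diag_coef l (act_tab (strans l) f)).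
(* [bt'] may be nonzero at a nonstandard filling; it is reset to 0 there, where [vext] is 0
   anyway. *)
exists (fun f => if standard f then bt' f else 0); split=> [f|]; last first.
  apply: eq_bigr => f _; case: ifP => // /negbT fN.
  by rewrite vext_nonstandard // !scaler0.
case: ifP => [fs|]; last by rewrite eqxx.
move=> bf; split=> //; have [b0|/btS[_ //]] := eqVneq (bt f) 0.
have [_ [g gS gE]] : standard (act_tab (strans l) f) /\
    exists2 g, perm_on S g & act_tab (strans l) f = act_tab g C.
  apply: btS; apply: contraNneq bf => b1.
  by rewrite /bt' b0 b1 !mul0r addr0.
exists (g * strans l)%g; first by rewrite perm_onM ?perm_on_strans.
by rewrite act_tabM -gE act_strans_invol.
Qed.

Lemma supported_Tvec d : perm_on S d -> supported (Tvec d).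
Proof.
have base : supported (Tvec 1%g).
  rewrite Tvec1; exists (fun f => (f == C)%:R); split=> [f|].
    have [-> _|_] := eqVneq f C; last by rewrite eqxx.
    split; first exact: col_reading_standard.
    by exists 1%g; rewrite ?perm_on1 ?act_tab1.
  rewrite (bigD1 C) //= eqxx scalar1 big1 ?addr0 // => f /negbTE ->.
  by rewrite scalar0.
move: {2}(len d) (erefl (len d)) => k; elim: k d => [|k IH] d dk dS;
    have [-> //|d1] := eqVneq d 1%g.
  by have [i /len_mul_strans_desc] := exists_left_descent d1; rewrite dk.
have [i di] := exists_left_descent d1.
have [ll lh] := seg_descent (perm_on_segV dS) di.
have dE := len_mul_strans_desc di.
have -> : Tvec d = T i *: Tvec (d * strans i)%g.
  rewrite /Tvec scalerA (T_mul_Tw T_comm T_braid) ?strans_mulK // invMg stransV !permM.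
  by rewrite strans_lo strans_hi.
apply: supported_T => //; apply: IH; first by move: dE; rewrite dk => -[].
by rewrite perm_onM ?perm_on_strans.
Qed.

(** Walk from [y] up its column to [a], one step right to [b], then up to [x]; each step raises the
    content by one. *)
Lemma seg_content x y : x \in S -> y \in S ->
    col (C y) = col (C a) -> col (C x) = col (C b) ->
  c (C x) - c (C y) =
    (1 + (row (C y) - row (C a)) + (row (C a) - row (C x)))%N%:R.
Proof.
move=> xS yS cy cx.
have rx : (row (C x) <= row (C b))%N by case: (seg_col ab_row ab_col xS); lia.
have ry : (row (C a) <= row (C y))%N by case: (seg_col ab_row ab_col yS); lia.
rewrite (content_col c_placed lam_part mu_part cx rx).
rewrite (content_row c_placed ab_row ab_col).
rewrite (content_col c_placed lam_part mu_part (esym cy) ry) ab_row !natrD.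
by ring.
Qed.

Variable d : 'S_n.
Hypotheses (dD : d \in D) (dab : (d b < d a)%N).

(** The coordinates are tied together by [chain]; the given [d] supplies a tableau at which one of
    them must vanish. *)
Lemma garnir_eq0 : garnir *: v (C_tab lam mu) = 0.
Proof.
case/garnir_setP: (dD) => dS dc; have ablt := garnir_ab_lt ab_col.
have aS : a \in S by rewrite in_seg leqnn ltnW.
have bS : b \in S by rewrite in_seg leqnn ltnW.
have supp : supported (garnir *: v (C_tab lam mu)).
  rewrite /garnir scaler_suml.
  under eq_bigr do rewrite scalar_alg.
  by apply: supported_sum => g /garnir_setP[gS _]; apply: supported_Tvec.
case: supp => bt [btS btE].
have btN f : ~~ standard f -> bt f = 0.
  by move=> fN; apply/eqP; apply: contraNT fN => /btS[].
(* The coefficient of v_f in the relation of [garnir_eigen]. *)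
have coord l f : lo l \in S -> hi l \in S -> standard f ->
    bt f * (q^-1 + diag_coef l f) +
    bt (act_tab (strans l) f) * (q^-1 + diag_coef l (act_tab (strans l) f)) = 0.
  move=> ll lh; move: f; apply: vext_free.
  have eig := garnir_eigen ll lh.
  rewrite btE scalerDl T_sum_vext // scaler_sumr -big_split /= in eig.
  rewrite -[RHS]eig; apply: eq_bigr => f _; rewrite scalar_mul -scalarD; congr (_ %:A *: _).
  by ring.
(* Two entries of the segment that may be exchanged lie in different columns
   and rows, so that the off-diagonal coefficients of [T_l] do not vanish. *)
have chain g : perm_on S g -> standard (act_tab g C) ->
    bt (act_tab g C) = 0 <-> bt C = 0.
  move: {2}(len g) (erefl (len g)) => k; elim: k g => [|k IH] g gk gS gs;
      have [->|g1] := eqVneq g 1%g; rewrite ?act_tab1 //.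
    by have [i /len_mul_strans_desc] := exists_left_descent g1; rewrite gk.
  have [l gl] := exists_left_descent g1.
  have [ll lh] := seg_descent (perm_on_segV gS) gl.
  have gE := len_mul_strans_desc gl.
  have gsS : perm_on S (g * strans l)%g by rewrite perm_onM ?perm_on_strans.
  have gss := standard_descent gs gl.
  have [|e1 e2] := IH _ _ gsS gss; first by move: gE; rewrite gk => -[].
  set x := g^-1%g (lo l) in gl; set y := g^-1%g (hi l) in gl.
  have xS : x \in S by rewrite perm_closed // perm_on_segV.
  have yS : y \in S by rewrite perm_closed // perm_on_segV.
  have [cy cx rxy] := descent_boxes ab_row ab_col gs gl xS yS.
  have cxy := seg_content xS yS cy cx.
  set m := (1 + _ + _)%N in cxy.
  have m2 : (2 <= m)%N.
    exact: rxy.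
  have [t1 t2] := tdiag_nat_neq q_neq0 q_nroot ell_log m2.
  have := coord l _ ll lh gs; rewrite -act_tabM.
  have -> : diag_coef l (act_tab g C) = tdiag q ell m%:R.
    by rewrite /diag_coef !act_tab_app cxy.
  have -> : diag_coef l (act_tab (g * strans l)%g C) = tdiag q ell (- m%:R).
    rewrite /diag_coef !act_tab_app invMg stransV !permM strans_lo strans_hi.
    by rewrite -cxy opprB.
  move=> e; split=> [b0|/e2 b0].
    apply: e1; move/eqP: e; rewrite b0 mul0r add0r mulf_eq0 (negbTE t2) orbF.
    by move/eqP.
  by move/eqP: e; rewrite b0 mul0r addr0 mulf_eq0 (negbTE t1) orbF => /eqP.
(* Exchanging [d a] and [d b], which are consecutive, makes the tableau
   standard with two consecutive entries in a row, where [T_l] acts by [q]. *)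
have [l [db da]] := garnir_max_consecutive ab_row ab_col dD dab.
have ll : lo l \in S by rewrite -db perm_closed.
have lh : hi l \in S by rewrite -da perm_closed.
have sS : perm_on S (d * strans l)%g by rewrite perm_onM ?perm_on_strans.
have ss := garnir_max_standard ab_row ab_col dD dab db da.
have dN : ~~ standard (act_tab d C).
  apply/negP => /standard_act /(_ a b); rewrite /precedes ab_row ab_col eqxx ltnSn /=.
  by move/(_ isT); rewrite ltnNge ltnW.
have := coord l _ ll lh ss; rewrite -act_tabM strans_mulK (btN _ dN) mul0r addr0.
have -> : diag_coef l (act_tab (d * strans l)%g C) = q.
  rewrite /diag_coef !act_tab_app invMg stransV !permM strans_lo strans_hi.
  rewrite -da -db !permK (content_row c_placed ab_row ab_col) opprD addrA subrr add0r.
  exact: tdiag_row.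
move/eqP; rewrite mulf_eq0 (negbTE (q_add_qV q_neq0 q_nroot)) orbF => /eqP bs0.
(* The vanishing passes from this tableau to [C], and from [C] to all others. *)
have b0 := (chain _ sS ss).1 bs0.
rewrite btE big1 // => f _; have [->|bf] := eqVneq (bt f) 0; first by rewrite scalar0.
have [fs [g gS fE]] := btS _ bf; rewrite fE in bf fs *.
by rewrite (chain _ gS fs).2 ?eqxx // in bf.
Qed.

(* [T_u'] carries the Garnir relation to the other cosets of S_[a, b], since
   lengths add up when [u'] is increasing on the segment. *)
Lemma Tvec_garnir u' : increasing_on S u' ->
  Tvec (d * u')%g = \sum_(g in D | g != d)
    (- ((- q) ^+ len d * (- q) ^- len g))%:A *: Tvec (g * u')%g.
Proof.
move=> u'S; have Nq0 : - q != 0 by rewrite oppr_eq0.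
(* The factor (-q)^(len d) turns the coefficient of [Tvec (d * u')] into 1. *)
have := congr1 (fun m => ((- q) ^+ len d)%:A *: (Tw T u' *: m)) garnir_eq0.
rewrite !scaler0 /garnir scaler_suml !scaler_sumr.
rewrite (eq_bigr (fun g => ((- q) ^+ len d * (- q) ^- len g)%:A *: Tvec (g * u')%g)).
  rewrite (bigD1 d) //= mulfV ?expf_neq0 // scalar1 => /eqP; rewrite addr_eq0 => /eqP ->.
  by rewrite -sumrN; apply: eq_bigr => g _; rewrite scalarN.
move=> g /garnir_setP[gS _].
rewrite (scalar_alg _ (Tw T g)) scalar_comm scalar_mul; congr (_ *: _).
by rewrite /Tvec (Tw_mul T_comm T_braid) ?scalerA // (len_mul_seg gS u'S).
Qed.

End Garnir.

(** * Straightening into the natural basis over the Laurent polynomials *)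

Definition laurent_span m : Prop := exists bt : std_tab lam mu -> R[i],
  (forall Q, in_Zqq q (bt Q)) /\ m = \sum_Q (bt Q)%:A *: nvec T v Q.

Lemma laurent_spanD m1 m2 :
  laurent_span m1 -> laurent_span m2 -> laurent_span (m1 + m2).
Proof.
move=> [b1 [b1Z ->]] [b2 [b2Z ->]]; exists (fun Q => b1 Q + b2 Q); split.
  by move=> Q; apply: in_ZqqD.
by rewrite -big_split; apply: eq_bigr => Q _; rewrite scalarD.
Qed.

Lemma laurent_spanZ z m : in_Zqq q z -> laurent_span m -> laurent_span (z%:A *: m).
Proof.
move=> zZ [bt [btZ ->]]; exists (fun Q => z * bt Q); split.
  by move=> Q; apply: in_ZqqM.
by rewrite scaler_sumr; apply: eq_bigr => Q _; rewrite scalar_mul.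
Qed.

Lemma laurent_span_sum (I : Type) (r : seq I) (P : pred I) (m : I -> M) :
  (forall i, P i -> laurent_span (m i)) -> laurent_span (\sum_(i <- r | P i) m i).
Proof.
move=> mP; elim/big_ind: _ => //; last exact: laurent_spanD.
exists (fun=> 0); split=> [Q|]; first exact: in_Zqq0.
by rewrite big1 // => Q _; rewrite scalar0.
Qed.

Lemma nvec_span Q : laurent_span (nvec T v Q).
Proof.
exists (fun Q' => (Q' == Q)%:R); split=> [Q'|].
  by case: (_ == _); [exact: in_Zqq1 | exact: in_Zqq0].
rewrite (bigD1 Q) //= eqxx scalar1 big1 ?addr0 // => Q' /negbTE ->.
by rewrite scalar0.
Qed.

Lemma Tvec_standard u (us : standard (act_tab u C)) : Tvec u = nvec T v (Sub _ us).
Proof.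
rewrite /nvec /tab_perm SubK; case: pickP => [w /eqP /act_tab_inj -> //|/(_ u)].
by rewrite eqxx.
Qed.

Lemma Tvec_span u : laurent_span (Tvec u).
Proof.
move: {2}(len u) (leqnn (len u)) => k; elim: k u => [|k IH] u uk.
  have [->|/exists_descent [l /len_strans_mul_desc]] := eqVneq u 1%g; last by lia.
  have us : standard (act_tab 1%g C) by rewrite act_tab1 col_reading_standard.
  by rewrite (Tvec_standard us); apply: nvec_span.
have [us|uN] := boolP (standard (act_tab u C)).
  by rewrite (Tvec_standard us); apply: nvec_span.
have [[l [cE hl]]|Nl] := pselect (exists l : 'I_n.-1,
    col (C (lo l)) = col (C (hi l)) /\ (u (hi l) < u (lo l))%N).
  rewrite (Tvec_col_descent cE hl); apply: laurent_spanZ; first exact/in_ZqqN/in_Zqq_qV.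
  by apply: IH; rewrite -ltnS -(len_strans_mul_desc hl).
have uc (l : 'I_n.-1) : col (C (lo l)) = col (C (hi l)) -> (u (lo l) < u (hi l))%N.
  by move=> cE; have [//|hl] := lohi_dec u l; case: Nl; exists l.
have ucol := increasing_col uc.
have [a [b [ab_row ab_col ba]]] := nonstandard_descent lam_part uc uN.
have [d [u' [dS uE u'S]]] := exists_seg_factor a b u.
(* As [u'] preserves order on the segment, [d] orders the segment as [u] does. *)
have d_mono x y : x \in seg a b -> y \in seg a b -> (u x < u y)%N -> (d x < d y)%N.
  move=> xS yS uxy; rewrite ltnNge leq_eqVlt; apply/norP; split.
    by apply/eqP => /val_inj /perm_inj yx; rewrite yx ltnn in uxy.
  apply/negP => /(u'S _ _ _ _); rewrite !perm_closed // => /(_ yS xS).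
  by rewrite -!permM -uE ltnNge (ltnW uxy).
have dD : d \in garnir_set a b.
  apply/garnir_setP; split=> // x y xS yS xy cE.
  by apply: d_mono => //; apply: ucol.
have ab := garnir_ab_lt ab_col.
have dab : (d b < d a)%N by apply: d_mono; rewrite // in_seg leqnn ltnW.
rewrite uE (Tvec_garnir ab_row ab_col dD dab u'S).
apply: laurent_span_sum => g /andP[gD gd]; apply: laurent_spanZ.
  apply/in_ZqqN/in_ZqqM; first exact/in_Zqq_expn/in_ZqqN/in_Zqq_q.
  by rewrite -exprVn invrN; apply/in_Zqq_expn/in_ZqqN/in_Zqq_qV.
apply: IH; have gS : perm_on (seg a b) g by case/garnir_setP: gD.
(* Both lengths are that of [u'] plus that of the segment factor, so the comparison of [g] with the
   longest element [d] decides. *)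
rewrite -ltnS; apply: leq_trans uk; rewrite uE (len_mul_seg gS u'S) (len_mul_seg dS u'S).
by rewrite ltn_add2l; apply: (garnir_max ab_row ab_col dD).
Qed.

(** T_i times T_w is again some T_w', up to adding (q - q^-1) T_w, and [Tvec_span] covers every
    permutation, standard or not. *)
Lemma T_span i m : laurent_span m -> laurent_span (T i *: m).
Proof.
move=> [bt [btZ ->]]; rewrite scaler_sumr; apply: laurent_span_sum => Q _.
rewrite scalar_comm; apply: laurent_spanZ => //.
rewrite /nvec scalerA; have [up|dn] := lohi_dec (tab_perm Q)^-1%g i.
  by rewrite (T_mul_Tw T_comm T_braid) //; apply: Tvec_span.
rewrite (T_mul_Tw_desc T_comm T_braid T_quad) // scalerDl scalar_alg.
apply: laurent_spanD; first exact: Tvec_span.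
apply: laurent_spanZ; last exact: Tvec_span.
by apply: (in_ZqqB q_neq0); [exact: in_Zqq_q | exact: in_Zqq_qV].
Qed.

Lemma Tw_span w m : laurent_span m -> laurent_span (Tw T w *: m).
Proof.
move=> ms; rewrite /Tw; elim: (xget _ _) => [|i r IH]; first by rewrite big_nil scale1r.
by rewrite big_cons -scalerA; apply: T_span.
Qed.

(** * The action of the x_i for integral contents *)

Variable x : 'I_n -> A.
Hypothesis x_unit : forall i, x i \is a GRing.unit.
Hypothesis x_comm : forall i j, x i * x j = x j * x i.
Hypothesis x_T : forall (i : 'I_n.-1) (g : 'I_n -> int),
  xmon x g * T i = T i * xmon x (sgamma i g) + (q - q^-1) *: xquot x i g.
Hypothesis x_v : forall (i : 'I_n) (L : std_tab lam mu),
  x i *: v L = (q2pow ell (c (val L i)))%:A *: v L.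
Hypothesis c_int : forall b : skew_box lam mu, exists k : int, c b = k%:~R.

(** Integrality of the contents enters here: it makes the eigenvalue an integral power of q. *)
Lemma x_C i : exists k : int, x i *: v (C_tab lam mu) = (q ^ k)%:A *: v (C_tab lam mu).
Proof.
have [k ck] := c_int (val (C_tab lam mu) i).
by exists (2 * k); rewrite x_v ck (q2pow_int q_neq0 ell_log).
Qed.

Lemma xz_C i (e : int) : exists k : int,
  x i ^ e *: v (C_tab lam mu) = (q ^ k)%:A *: v (C_tab lam mu).
Proof.
have expn_C (h : A) (s : int) : h *: v (C_tab lam mu) = (q ^ s)%:A *: v (C_tab lam mu) ->
    forall k : nat, exists s' : int,
      h ^+ k *: v (C_tab lam mu) = (q ^ s')%:A *: v (C_tab lam mu).
  move=> hE; elim=> [|k [s' IH]]; first by exists 0; rewrite scale1r scalar1.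
  exists (s' + s); rewrite exprS -scalerA IH scalar_comm hE scalar_mul.
  by rewrite -expfzDr.
have [s xs] := x_C i.
case: e => k; first exact: expn_C xs _.
rewrite NegzE -exprnN -exprVn; apply: (expn_C _ (- s)).
(* v_C is written as q^-s (q^s v_C) and q^s v_C as x_i v_C, which the inverse of x_i cancels. *)
rewrite -[X in _ *: X](@scalar1 _) -(@mulVf _ (q ^ s)) ?expfz_neq0 // -scalar_mul.
by rewrite -xs scalar_comm scalerA mulVr // scale1r -invr_expz.
Qed.

Lemma xmon_C (g : 'I_n -> int) : laurent_span (xmon x g *: v (C_tab lam mu)).
Proof.
have vs : laurent_span (v (C_tab lam mu)).
  by have := Tvec_span 1%g; rewrite /Tvec (Tw1 T_comm T_braid) scale1r.
suff [k ->] : exists k : int, xmon x g *: v (C_tab lam mu) = (q ^ k)%:A *: v (C_tab lam mu).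
  by apply: laurent_spanZ => //; apply: in_Zqq_expz.
rewrite /xmon; elim: (index_enum _) => [|i r [k IH]].
  by exists 0; rewrite big_nil scale1r scalar1.
have [s xs] := xz_C i (g i); exists (k + s).
by rewrite big_cons -scalerA IH scalar_comm xs scalar_mul -expfzDr.
Qed.

(** Induction on the word for all exponents at once: moving a monomial past T_i produces other
    monomials, [xquot] being a signed sum of these. *)
Lemma xmon_word (r : seq 'I_n.-1) (g : 'I_n -> int) :
  laurent_span (xmon x g *: ((\prod_(i <- r) T i) *: v (C_tab lam mu))).
Proof.
elim: r g => [|i r IH] g; first by rewrite big_nil scale1r; apply: xmon_C.
rewrite scalerA big_cons mulrA x_T mulrDl scalerDl -!scalerA scalar_alg.
apply: laurent_spanD; first exact/T_span/IH.
apply: laurent_spanZ; first by apply: (in_ZqqB q_neq0); [exact: in_Zqq_q | exact: in_Zqq_qV].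
rewrite /xquot -scalerA scaler_suml.
have sumS (a b : int) : laurent_span
    (\sum_(k < `|b - a|%N) xmon x (set_lohi i g (Num.min a b + k%:Z) (Num.max a b - k%:Z))
      *: (\prod_(j <- r) T j *: v (C_tab lam mu))).
  by apply: laurent_span_sum => k _; apply: IH.
case: ifP => _; first by rewrite scale1r.
rewrite scaleN1r -[X in - X]scalar1 -scalarN; apply: laurent_spanZ => //.
exact: (in_Zqq_int q (-1)).
Qed.

Lemma x_nvec i L : laurent_span (x i *: nvec T v L).
Proof.
suff -> : x i = xmon x (fun j => (j == i)%:Z) by apply: xmon_word.
(* 1 is the monomial with exponents 0, to which [xmon_mulr] adds the factor x_i. *)
rewrite -[LHS]mul1r; have -> : 1 = xmon x (fun=> 0).
  by rewrite /xmon big1.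
by rewrite xmon_mulr.
Qed.

End SkewModule.

Theorem proposition5p6 (R : realType) (q ell : R[i])
    (q_neq0 : q != 0) (q_nroot : forall k : nat, (0 < k)%N -> q ^+ k != 1)
    (ell_log : cexp ell = q ^+ 2)
    (lam mu : seq nat) (lam_part : is_partition lam)
    (mu_part : is_partition mu) (mu_sub : subpartition mu lam)
    (c : skew_box lam mu -> R[i]) (c_placed : placed ell c)
    (A : unitAlgType R[i])
    (T : 'I_(nboxes lam mu).-1 -> A) (x : 'I_(nboxes lam mu) -> A)
    (A_hecke : is_affine_hecke_algebra q T x)
    (M : lmodType A) (v : std_tab lam mu -> M)
    (M_skew : is_skew_module q ell c T x v) :
  (forall (w : 'S_(nboxes lam mu)) (L : std_tab lam mu),
     exists b : std_tab lam mu -> R[i],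
       (forall Q, in_Zqq q (b Q)) /\
       Tw T w *: nvec T v L = \sum_(Q : std_tab lam mu) (b Q)%:A *: nvec T v Q)
  /\
  ((forall b : skew_box lam mu, exists m : int, c b = m%:~R) ->
   forall (i : 'I_(nboxes lam mu)) (L : std_tab lam mu),
     exists b' : std_tab lam mu -> R[i],
       (forall Q, in_Zqq q (b' Q)) /\
       x i *: nvec T v L = \sum_(Q : std_tab lam mu) (b' Q)%:A *: nvec T v Q).
Proof.
have [[[x_unit x_comm] T_comm T_braid T_quad x_T] _] := A_hecke.
have [v_basis x_v T_v] := M_skew.
split=> [w L|c_int i L].
  exact: (Tw_span q_neq0 q_nroot ell_log lam_part mu_part c_placed T_comm T_braid
    T_quad v_basis T_v w (nvec_span q T v L)).
exact: (x_nvec q_neq0 q_nroot ell_log lam_part mu_part c_placed T_comm T_braid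
  T_quad v_basis T_v x_unit x_comm x_T x_v c_int i L).
Qed.
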